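(* Let $t \in T$ and let $v \in \mathbb{Q}^3$ with $|v| = \sqrt{t}$. Let $h = \frac{m}{n}$ with $m,n$ positive integers and $\gcd(m,n)=1$. Let $S$ be the set of all vectors in $\mathbb{Q}^3$ of Euclidean length $\sqrt{h}$, and let $\Phi(S)$ be the set of all vectors obtainable as finite sums of elements of $S$ (under the usual vector addition). Let $n_0$ denote the square-free part of $n$. If at least one of the following holds: (1) $m \equiv 2 \pmod 4$; (2) $n_0$ is even; (3) $n_0$ is odd and $m n_0 \equiv 1 \pmod 4$; then $v \in \Phi(S)$.
   Context: $T$ denotes the set of all square-free, even positive integers having at least one odd prime factor congruent to $2$ modulo $3$ (so $T = \{10, 22, 30, 34, 46, 58, 66, \ldots\}$). $|v|$ denotes the Euclidean norm. The square-free part of a positive integer $n$ is the unique square-free integer $n_0$ such that $n = n_0 k^2$ for some integer $k$. *)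

(* Defs.v *)
From HB Require Import structures.
From mathcomp Require Import all_boot all_order all_algebra.
From mathcomp Require Import classical_sets reals.

Set Implicit Arguments.
Unset Strict Implicit.
Unset Printing Implicit Defensive.

Import Order.TTheory GRing.Theory Num.Theory.
Local Open Scope ring_scope.

(* [squarefree 0] is false, since 2 ^ 2 divides 0. *)
Definition squarefree (n : nat) : Prop :=
  forall d : nat, (d ^ 2 %| n)%N -> d = 1%N.

Definition is_squarefree_part (n n0 : nat) : Prop :=
  squarefree n0 /\ exists k : nat, n = (n0 * k ^ 2)%N.

Definition T : set nat :=
  fun t => [/\ (0 < t)%N, squarefree t, ~~ odd t
    & exists p : nat, [/\ prime p, odd p, (p %| t)%N & p = 2 %[mod 3]]].

(* The norm is real-valued: [Num.sqrt] is not available on [rat]. *)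
Definition enorm (R : realType) (d : nat) (v : 'rV[rat]_d) : R :=
  Num.sqrt (\sum_(i < d) ratr (v ord0 i) ^+ 2).

Definition rat_sphere (R : realType) (h : rat) : set 'rV[rat]_3 :=
  fun v => enorm R v = Num.sqrt (ratr h).

Definition finite_sums (S : set 'rV[rat]_3) : set 'rV[rat]_3 :=
  fun v => exists s : seq 'rV[rat]_3,
    (forall x, x \in s -> S x) /\ v = \sum_(x <- s) x.

(* Main.v *)
Require Import Defs.
From HB Require Import structures.
From mathcomp Require Import all_boot all_order all_algebra.
From mathcomp Require Import all_fingroup cyclic.
From mathcomp Require Import classical_sets reals.
From mathcomp Require Import zify ring lra.

Set Implicit Arguments.
Unset Strict Implicit.
Unset Printing Implicit Defensive.

Import Order.TTheory GRing.Theory Num.Theory.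
Local Open Scope ring_scope.

(* Rescaling turns S into the rational vectors of squared length M = m n0, and M is 1 or 2 mod 4.

   Such an M is a sum of three squares. For M squarefree, this needs an integer b with -b a local
   norm from Q(sqrt(-M)) at every odd prime: Legendre's pigeonhole then yields a small vector of a
   positive ternary form of determinant 1, and Thue's lemma finishes. Dirichlet's theorem on
   primes is not needed to find b. Take signed products of primes up to 2M, without one fixed
   prime divisor of M, and their local characters at the non-split places other than 2. If r
   primes up to 2M are split, there are exactly r more generators than characters, so if the
   wanted b did not exist there would be r + 1 independent local norms. By Legendre's theorem
   these are norms, up to squares of integers at most 2M, of elements of Z[sqrt(-M)]; modulo
   Q^* and sqrt(-M) such elements generate a group of rank at most r, a contradiction.

   The group generated by a rational sphere is stable under all rational isometries. Unit vectors
   with denominator divisible by p (from 1 + s^2 + t^2 = 0 mod p) make it stable under division by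
   every odd number, so that only the residues mod 2 matter; a rational vector of even integral
   squared length has odd denominators and an even coordinate sum. *)

(** * Squarefree numbers and quadratic residues *)

Lemma squarefree_gt0 n : squarefree n -> (0 < n)%N.
Proof. by case: n => // /(_ 2%N); rewrite dvdn0 => /(_ isT). Qed.

Lemma squarefree_dvd d n : (d %| n)%N -> squarefree n -> squarefree d.
Proof. by move=> dn sqn c cd; apply: sqn (dvdn_trans cd dn). Qed.

Lemma squarefree_coprime a b : squarefree (a * b) -> coprime a b.
Proof.
move=> sqab; apply/eqP/sqab.
by rewrite expnS expn1 dvdn_mul ?dvdn_gcdl ?dvdn_gcdr.
Qed.

Lemma squarefree_prime_sqr p n : prime p -> squarefree n -> ~~ (p ^ 2 %| n)%N.
Proof. by move=> pp sqn; apply/negP => /sqn p1; rewrite p1 in pp. Qed.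

Lemma squarefree_part_exists n : (0 < n)%N -> exists n0, is_squarefree_part n n0.
Proof.
elim/ltn_ind: n => n IH n_gt0.
have [/existsP[d /andP[d_gt1 dn]]|nod] :=
  boolP [exists d : 'I_n.+1, (1 < d)%N && (d ^ 2 %| n)%N].
  have q_gt0 : (0 < n %/ d ^ 2)%N.
    by rewrite divn_gt0 ?expn_gt0 ?(ltnW d_gt1) // dvdn_leq.
  have [|n0 [sq0 [k nk]]] := IH (n %/ d ^ 2)%N _ q_gt0.
    by rewrite ltn_Pdiv // (@leq_trans (2 ^ 2)) // leq_sqr.
  exists n0; split=> //; exists (k * d)%N.
  by rewrite expnMn mulnA -nk divnK.
exists n; split; last by exists 1%N; rewrite muln1.
move=> d dn; apply/eqP; apply: contraNT nod => d_neq1.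
have d_gt0 : (0 < d)%N by case: d dn d_neq1 => //; rewrite dvd0n; case: (n) n_gt0.
have le_dn : (d < n.+1)%N.
  by rewrite ltnS (leq_trans _ (dvdn_leq n_gt0 dn)) // expnS expn1 leq_pmulr.
apply/existsP; exists (Ordinal le_dn); rewrite /= dn andbT; lia.
Qed.

Lemma dvdz_Fp p (x : int) : prime p -> (p%:Z %| x)%Z = (x%:~R == 0 :> 'F_p).
Proof.
move=> pp.
have dvd_nat (n : nat) : (p %| n)%N = (n%:R == 0 :> 'F_p).
  by rewrite -(dvdn_pcharf (pchar_Fp pp)).
rewrite dvdzE absz_nat dvd_nat.
case: x => n /=; first by rewrite -pmulrn.
by rewrite NegzE mulrNz oppr_eq0 -pmulrn.
Qed.

Lemma Euclid_dvdz p (x y : int) : prime p ->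
  (p%:Z %| x * y)%Z = (p%:Z %| x)%Z || (p%:Z %| y)%Z.
Proof. by move=> pp; rewrite !dvdzE abszM Euclid_dvdM. Qed.

Lemma Euclid_dvdz_sqr p (x : int) : prime p ->
  (p%:Z %| x ^+ 2)%Z = (p%:Z %| x)%Z.
Proof. by move=> pp; rewrite expr2 Euclid_dvdz // orbb. Qed.

Lemma Fp_int p (x : 'F_p) : exists c : int, x = c%:~R.
Proof. by exists (x : nat)%:Z; rewrite -pmulrn natr_Zp. Qed.

Definition qres (n : nat) (c : int) : Prop := exists s : int, (n%:Z %| s ^+ 2 - c)%Z.

Definition qresb (n : nat) (c : int) : bool :=
  [exists s : 'I_n, (n%:Z %| s%:Z ^+ 2 - c)%Z].

Lemma dvdz_sqr_mod (n x y c : int) :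
  (x = y %[mod n])%Z -> (n %| y ^+ 2 - c)%Z -> (n %| x ^+ 2 - c)%Z.
Proof.
move=> xy /dvdz_mod0P nx; apply/dvdz_mod0P.
by rewrite -modzDml -modzXm xy modzXm modzDml.
Qed.

Lemma qresP n c : (0 < n)%N -> reflect (qres n c) (qresb n c).
Proof.
move=> n_gt0; apply: (iffP existsP) => -[s]; first by exists s%:Z.
move=> ns; have n_neq0 : n%:Z != 0 by lia.
have sn : (`|(s %% n%:Z)%Z| < n)%N by have := ltz_pmod s (d := n); have := modz_ge0 s n_neq0; lia.
exists (Ordinal sn) => /=.
rewrite gez0_abs ?modz_ge0 //.
by apply: dvdz_sqr_mod ns; rewrite modz_mod.
Qed.

Lemma qres_Fp p c : prime p -> qres p c <-> exists x : 'F_p, x ^+ 2 = c%:~R.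
Proof.
move=> pp; split=> [[s]|[x]].
  by rewrite dvdz_Fp // rmorphB rmorphXn subr_eq0 => /eqP; exists s%:~R.
have [s ->] := Fp_int x => xc; exists s.
by rewrite dvdz_Fp // rmorphB rmorphXn /= xc subrr.
Qed.

Lemma qres2 c : qres 2 c.
Proof.
exists c; rewrite (_ : _ - c = c * (c - 1)); last by ring.
by rewrite Euclid_dvdz //; lia.
Qed.

Lemma qres_sqr n c : qres n (c ^+ 2).
Proof. by exists c; rewrite subrr dvdz0. Qed.

Lemma qres_cong n c d : (n%:Z %| c - d)%Z -> qres n c -> qres n d.
Proof.
move=> cd [s sc]; exists s.
by rewrite (_ : _ - d = (s ^+ 2 - c) + (c - d)); [apply: rpredD | ring].
Qed.

Lemma qres_mul n c d : qres n c -> qres n d -> qres n (c * d).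
Proof.
move=> [s sc] [r rd]; exists (s * r).
rewrite (_ : _ - _ = (s ^+ 2 - c) * r ^+ 2 + c * (r ^+ 2 - d)); last by ring.
by apply: rpredD; [apply: dvdz_mulr | apply: dvdz_mull].
Qed.

Lemma qres_sqr_cancel p c d : prime p -> ~~ (p%:Z %| d)%Z -> qres p (c * d ^+ 2) -> qres p c.
Proof.
move=> pp; rewrite dvdz_Fp // => d0 /qres_Fp[//|x xc].
apply/qres_Fp => //; exists (x / d%:~R).
by rewrite expr_div_n xc rmorphM rmorphXn /= mulfK // expf_eq0.
Qed.

Lemma Fp_generator p : prime p -> exists g : 'F_p, forall x, x != 0 -> exists k, x = g ^+ k.
Proof.
move=> pp.
have /cyclicP[g defG] := field_unit_group_cyclic [group of [set: {unit 'F_p}]].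
exists (FinRing.uval g) => x x0.
have ux : x \is a GRing.unit by rewrite unitfE.
have : FinRing.unit 'F_p ux \in <[g]>%g by rewrite -defG inE.
by case/cycleP=> k /(congr1 val) /= ->; exists k; rewrite FinRing.val_unitX.
Qed.

(** Both factors are odd powers of a generator of the cyclic unit group of F_p, so the product is an
    even power. *)
Lemma qres_nonres_mul p c d : prime p -> ~~ (p%:Z %| c)%Z -> ~~ (p%:Z %| d)%Z ->
  ~ qres p c -> ~ qres p d -> qres p (c * d).
Proof.
move=> pp; rewrite !dvdz_Fp // => c0 d0 nc nd.
have [g gP] := Fp_generator pp.
have odd_exp e : e%:~R != 0 :> 'F_p -> ~ qres p e ->
    exists k, e%:~R = g ^+ k.*2.+1 :> 'F_p.
  move=> e0 ne; have [k ek] := gP _ e0; exists k./2.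
  rewrite ek -{1}(odd_double_half k); case: (boolP (odd k)) => // /negbTE ok.
  case: ne; apply/qres_Fp => //; exists (g ^+ k./2).
  by rewrite ek -exprM muln2 -{2}(odd_double_half k) ok.
have [i ei] := odd_exp c c0 nc; have [j ej] := odd_exp d d0 nd.
apply/qres_Fp => //; exists (g ^+ (i + j).+1).
by rewrite rmorphM /= ei ej -exprM -exprD; congr (_ ^+ _); lia.
Qed.

(** The quadratic character written additively, with booleans under xor as values, as the linear
    algebra over F_2 requires. *)
Lemma qresb_mul p c d : prime p -> ~~ (p%:Z %| c)%Z -> ~~ (p%:Z %| d)%Z ->
  ~~ qresb p (c * d) = ~~ qresb p c (+) ~~ qresb p d.
Proof.
move=> pp pc pd; have p_gt0 := prime_gt0 pp.
have [qc|nc] := boolP (qresb p c); have [qd|nd] := boolP (qresb p d) => /=.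
- apply: negbTE; rewrite negbK; apply/qresP => //.
  by apply: qres_mul; apply/qresP.
- apply/negP => /qresP-/(_ p_gt0) qcd; case/negP: nd; apply/qresP => //.
  apply: (@qres_sqr_cancel _ _ c) => //.
  rewrite (_ : d * c ^+ 2 = (c * d) * c); last by ring.
  by apply: qres_mul => //; apply/qresP.
- apply/negP => /qresP-/(_ p_gt0) qcd; case/negP: nc; apply/qresP => //.
  apply: (@qres_sqr_cancel _ _ d) => //.
  rewrite (_ : c * d ^+ 2 = (c * d) * d); last by ring.
  by apply: qres_mul => //; apply/qresP.
- apply: negbTE; rewrite negbK; apply/qresP => //.
  by apply: qres_nonres_mul => // /qresP-/(_ p_gt0); apply/negP.
Qed.

Lemma qres_coprime_mul a b c : coprime a b -> qres a c -> qres b c -> qres (a * b) c.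
Proof.
move=> cab [s sa] [r rb].
have cabz : coprimez a b by rewrite coprimezE.
exists (zchinese a b s r); rewrite PoszM Gauss_dvdz //.
by rewrite (dvdz_sqr_mod (zchinese_modl cabz _ _) sa)
           (dvdz_sqr_mod (zchinese_modr cabz _ _) rb).
Qed.

(** Chinese remaindering, one prime divisor at a time; squarefreeness makes the cofactor coprime to
    it. *)
Lemma qres_squarefree n c : squarefree n ->
  (forall p, prime p -> (p %| n)%N -> qres p c) -> qres n c.
Proof.
elim/ltn_ind: n => n IH sqn qp; have n_gt0 := squarefree_gt0 sqn.
have [n_le1|n_gt1] := leqP n 1.
  have -> : n = 1%N by lia.
  by exists 0; apply: dvd1z.
have pp := pdiv_prime n_gt1; have pn := pdiv_dvd n.
have qn : (n %/ pdiv n %| n)%N by apply: dvdn_div.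
rewrite -(divnK pn); apply: qres_coprime_mul; last exact: qp.
- by apply: squarefree_coprime; rewrite divnK.
- apply: IH => [||p pr pd]; first by rewrite ltn_Pdiv ?prime_gt1.
  + exact: squarefree_dvd sqn.
  + by apply: qp => //; apply: dvdn_trans qn.
Qed.

(** * Legendre's theorem by pigeonhole *)

Lemma pigeonhole (T T' : finType) (f : T -> T') :
  (#|T'| < #|T|)%N -> exists x y, x != y /\ f x = f y.
Proof.
move=> lt; have : ~~ injectiveb f.
  by apply/injectiveP => /leq_card; rewrite leqNgt lt.
by case/injectivePn=> x [y xy fxy]; exists x, y.
Qed.

Lemma residue_map n : (0 < n)%N ->
  exists f : int -> 'I_n, forall x y, f x = f y -> (n%:Z %| x - y)%Z.
Proof.
case: n => // n _; exists (fun x => inord `|(x %% n.+1%:Z)%Z|) => x y.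
have lt z : (`|(z %% n.+1%:Z)%Z| < n.+1)%N.
  by have := ltz_pmod z (d := n.+1) isT; have := modz_ge0 z (d := n.+1) isT; lia.
move/(congr1 (@nat_of_ord _)); rewrite !inordK // => xy.
rewrite -eqz_mod_dvd; apply/eqP.
by have := modz_ge0 x (d := n.+1) isT; have := modz_ge0 y (d := n.+1) isT; lia.
Qed.

(** For this s the range 0..s has more than sqrt n elements, while its differences have square at
    most n: the two facts behind the box arguments below. *)
Lemma sqrtn_exists n : exists s, (s ^ 2 <= n < s.+1 ^ 2)%N.
Proof.
elim: n => [|n [s /andP[le lt]]]; first by exists 0%N.
have [|lt'] := leqP (s.+1 ^ 2) n.+1; last by exists s; lia.
by exists s.+1; nia.
Qed.

Lemma dist_ord_sqr s n (x y : 'I_s.+1) : (s ^ 2 <= n)%N -> (x%:Z - y%:Z) ^+ 2 <= n%:Z.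
Proof. by case: x y => x xs [y ys] /=; nia. Qed.

Lemma ord_sub_eq0 n (x y : 'I_n) : (x%:Z - y%:Z == 0) = (x == y).
Proof. by rewrite subr_eq0 eqz_nat. Qed.

Lemma thue n (r : int) : (0 < n)%N ->
  exists x y : int, [/\ (x != 0) || (y != 0), x ^+ 2 <= n%:Z, y ^+ 2 <= n%:Z
    & (n%:Z %| x - r * y)%Z].
Proof.
move=> n_gt0; have [f fP] := residue_map n_gt0.
have [s /andP[sn ns]] := sqrtn_exists n.
have [|[x y] [[x' y'] [neq /fP dvd]]] := @pigeonhole ('I_s.+1 * 'I_s.+1)%type 'I_n
  (fun p => f (p.1%:Z - r * p.2%:Z)).
  by rewrite card_prod !card_ord; lia.
exists (x%:Z - x'%:Z), (y%:Z - y'%:Z); split; try exact: dist_ord_sqr.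
- by rewrite !ord_sub_eq0 -negb_and -xpair_eqE.
- by move: dvd => /=; congr (_ %| _)%Z; ring.
Qed.

(** The residue conditions split the form into linear factors modulo each of A, B and C. Killing one
    factor per modulus takes three linear congruences, and the box with sides sqrt(BC), sqrt(AC),
    sqrt(AB) has more than ABC points. *)
Lemma legendre_pigeonhole (A B C : nat) (c r1 r2 r3 : int) :
  (0 < A)%N -> (0 < B)%N -> (0 < C)%N ->
  coprime A B -> coprime A C -> coprime B C ->
  (C%:Z %| c)%Z ->
  (A%:Z %| r1 ^+ 2 + B%:Z * c)%Z -> (B%:Z %| r2 ^+ 2 + A%:Z * c)%Z ->
  (C%:Z %| r3 ^+ 2 + A%:Z * B%:Z)%Z ->
  exists u v w : int,
    [/\ [|| u != 0, v != 0 | w != 0], u ^+ 2 <= (B * C)%:Z, v ^+ 2 <= (A * C)%:Z,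
        w ^+ 2 <= (A * B)%:Z
      & ((A * B * C)%:Z %| A%:Z * u ^+ 2 + B%:Z * v ^+ 2 + c * w ^+ 2)%Z].
Proof.
move=> A0 B0 C0 cAB cAC cBC Cc hA hB hC.
have [fA fAP] := residue_map A0; have [fB fBP] := residue_map B0.
have [fC fCP] := residue_map C0.
have [s1 /andP[s1n ns1]] := sqrtn_exists (B * C).
have [s2 /andP[s2n ns2]] := sqrtn_exists (A * C).
have [s3 /andP[s3n ns3]] := sqrtn_exists (A * B).
have [|[[u v] w] [[[u' v'] w'] [neq]]] :=
  @pigeonhole ('I_s1.+1 * 'I_s2.+1 * 'I_s3.+1)%type ('I_A * 'I_B * 'I_C)%type
  (fun p => (fA (B%:Z * p.1.2%:Z - r1 * p.2%:Z), fB (A%:Z * p.1.1%:Z - r2 * p.2%:Z),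
             fC (A%:Z * p.1.1%:Z - r3 * p.1.2%:Z))).
  rewrite !card_prod !card_ord -ltn_sqr.
  have -> : ((A * B * C) ^ 2 = (B * C) * (A * C) * (A * B))%N by ring.
  rewrite !expnMn; apply: ltn_mul => //; exact: ltn_mul.
case=> /= /fAP dA /fBP dB /fCP dC.
exists (u%:Z - u'%:Z), (v%:Z - v'%:Z), (w%:Z - w'%:Z); split; try exact: dist_ord_sqr.
  by rewrite !ord_sub_eq0 orbA -!negb_and -!xpair_eqE.
move: dA dB dC; rewrite (_ : _ - _ - _ = B%:Z * (v%:Z - v'%:Z) - r1 * (w%:Z - w'%:Z)); last by ring.
rewrite (_ : _ - _ - (_ - r2 * _) = A%:Z * (u%:Z - u'%:Z) - r2 * (w%:Z - w'%:Z)); last by ring.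
rewrite (_ : _ - _ - (_ - r3 * _) = A%:Z * (u%:Z - u'%:Z) - r3 * (v%:Z - v'%:Z)); last by ring.
move: (u%:Z - u'%:Z) (v%:Z - v'%:Z) (w%:Z - w'%:Z) => {neq u v w u' v' w'} u v w.
move=> /dvdzP[a Ha] /dvdzP[b Hb] /dvdzP[d Hd].
move: hA hB hC Cc => /dvdzP[a' Ha'] /dvdzP[b' Hb'] /dvdzP[d' Hd'] /dvdzP[c' Hc'].
rewrite !PoszM Gauss_dvdz; last by rewrite coprimezE -PoszM /= coprimeMl cAC.
rewrite Gauss_dvdz; last by rewrite coprimezE.
have cBA : coprimez A B by rewrite coprimezE.
apply/andP; split; first apply/andP; first split.
(* Modulo A, after multiplication by the unit B, the form is (B v - r1 w)(B v + r1 w); the other two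
   moduli are similar. *)
- rewrite -(@Gauss_dvdzr _ B) //; apply/dvdzP.
  exists (a * (B%:Z * v + r1 * w) + a' * w ^+ 2 + B%:Z * u ^+ 2).
  transitivity ((a * A%:Z) * (B%:Z * v + r1 * w) + (a' * A%:Z) * w ^+ 2
    + A%:Z * B%:Z * u ^+ 2); last by ring.
  by rewrite -Ha -Ha'; ring.
- rewrite -(@Gauss_dvdzr _ A) 1?coprimez_sym //; apply/dvdzP.
  exists (b * (A%:Z * u + r2 * w) + b' * w ^+ 2 + A%:Z * v ^+ 2).
  transitivity ((b * B%:Z) * (A%:Z * u + r2 * w) + (b' * B%:Z) * w ^+ 2
    + A%:Z * B%:Z * v ^+ 2); last by ring.
  by rewrite -Hb -Hb'; ring.
- rewrite -(@Gauss_dvdzr _ A) ?coprimezE 1?coprime_sym //; apply/dvdzP.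
  exists (d * (A%:Z * u + r3 * v) + d' * v ^+ 2 + A%:Z * c' * w ^+ 2).
  transitivity ((d * C%:Z) * (A%:Z * u + r3 * v) + (d' * C%:Z) * v ^+ 2
    + A%:Z * (c' * C%:Z) * w ^+ 2); last by ring.
  by rewrite -Hd -Hd' -Hc'; ring.
Qed.

Lemma logn_squarefree p n : prime p -> squarefree n -> (p %| n)%N -> logn p n = 1%N.
Proof.
move=> pp sqn pn; have n_gt0 := squarefree_gt0 sqn.
apply/eqP; rewrite eqn_leq -pfactor_dvdn // expn1 pn andbT leqNgt -pfactor_dvdn //.
exact: squarefree_prime_sqr.
Qed.

Lemma squarefree_nonsquare n (x y : int) :
  squarefree n -> (1 < n)%N -> x ^+ 2 = n%:Z * y ^+ 2 -> y = 0.
Proof.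
move=> sqn n_gt1 xy; have pp := pdiv_prime n_gt1.
apply/eqP; apply/negP => /negP y0.
have : (`|x| ^ 2 = n * `|y| ^ 2)%N.
  by rewrite -!abszX -[n in RHS]/`|n%:Z|%N -abszM xy.
move/(congr1 (logn (pdiv n))); rewrite lognM ?expn_gt0 ?absz_gt0 ?y0 //; last exact: ltnW.
rewrite !lognX (logn_squarefree pp sqn (pdiv_dvd n)); lia.
Qed.

Lemma coprime_decomp (x y : int) : (x != 0) || (y != 0) ->
  exists d x' y' : int, [/\ 0 < d, x = d * x', y = d * y' & coprimez x' y'].
Proof.
move=> xy0; have d0 : gcdz x y != 0 by rewrite gcdz_eq0 negb_and.
have dE : 0 < gcdz x y by rewrite lt0r d0.
have /dvdzP[x' ex] := dvdz_gcdl x y; have /dvdzP[y' ey] := dvdz_gcdr x y.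
exists (gcdz x y), x', y'; rewrite dE mulrC -ex mulrC -ey; split=> //.
have := mulz_gcdl x' y' (gcdz x y); rewrite -ex -ey gtz0_abs // => /eqP.
by rewrite -subr_eq0 -{2}[gcdz x y]mul1r -mulrBl mulf_eq0 (negbTE d0) orbF subr_eq0.
Qed.

Lemma coprimez_prime_dvd p (x y : int) : prime p -> coprimez x y ->
  (p%:Z %| x)%Z -> (p%:Z %| y)%Z -> False.
Proof.
move=> pp /eqP cxy px py; have : (p%:Z %| gcdz x y)%Z by rewrite dvdz_gcd px.
by rewrite cxy dvdz1 /=; move: pp; case: p {px py} => // -[].
Qed.

Lemma qres_neg_of_dvd p M (x y : int) : prime p -> coprimez x y -> ~~ (p %| M)%N ->
  (p%:Z %| x ^+ 2 + M%:Z * y ^+ 2)%Z -> ~~ (p%:Z %| y)%Z /\ qres p (- M%:Z).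
Proof.
move=> pp cxy pM pN.
have py : ~~ (p%:Z %| y)%Z.
  apply/negP => py; apply: (coprimez_prime_dvd pp cxy) => //.
  move: pN; rewrite rpredDr ?Euclid_dvdz_sqr //.
  by apply: dvdz_mull; rewrite Euclid_dvdz_sqr.
split=> //; apply: (qres_sqr_cancel pp py); exists x.
by rewrite mulNr opprK.
Qed.

(** The gcd of x and y contributes an even exponent, so p also divides the value at the primitive
    part. *)
Lemma qres_neg_of_odd_logn p M (x y : int) : prime p -> ~~ (p %| M)%N ->
  odd (logn p `|x ^+ 2 + M%:Z * y ^+ 2|) -> qres p (- M%:Z).
Proof.
move=> pp pM oN; have N0 : x ^+ 2 + M%:Z * y ^+ 2 != 0.
  by apply: contraL oN => /eqP ->; rewrite absz0 logn0.
have xy0 : (x != 0) || (y != 0).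
  by apply: contraR N0; rewrite negb_or !negbK => /andP[/eqP -> /eqP ->]; apply/eqP; ring.
have [d [x' [y' [d0 ex ey cxy]]]] := coprime_decomp xy0.
have eN : x ^+ 2 + M%:Z * y ^+ 2 = d ^+ 2 * (x' ^+ 2 + M%:Z * y' ^+ 2).
  by rewrite ex ey; ring.
have [|//] := qres_neg_of_dvd pp cxy pM (x := x') (y := y').
have n0 : x' ^+ 2 + M%:Z * y' ^+ 2 != 0.
  by apply: contraNneq N0; rewrite eN => ->; rewrite mulr0.
move: oN; rewrite eN abszM lognM ?absz_gt0 ?expf_neq0 ?(gt_eqF d0) //.
rewrite abszX lognX oddD oddM /= dvdzE absz_nat => on.
rewrite -[p]expn1 pfactor_dvdn ?absz_gt0 //.
by case: logn on.
Qed.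

(** * Representation by x^2 + y^2 and x^2 + 2 y^2 *)

(** With r^2 = -k modulo n, Thue's lemma gives x^2 + k y^2 = c n with 0 < c < 1 + k. *)
Lemma sum_form_of_qres k n : (k == 1%N) || (k == 2%N) -> squarefree n ->
  qres n (- k%:Z) -> exists x y : int, n%:Z = x ^+ 2 + k%:Z * y ^+ 2.
Proof.
move=> k12 sqn [r nr]; have n_gt0 := squarefree_gt0 sqn.
have [n_le1|n_gt1] := leqP n 1.
  by exists 1, 0; rewrite (_ : n = 1%N); [ring | lia].
have [x [y [xy0 xn yn]]] := thue r n_gt0.
move=> /dvdzP[a ea]; case/dvdzP: nr => b eb.
have : (n%:Z %| x ^+ 2 + k%:Z * y ^+ 2)%Z.
  apply/dvdzP; exists (a * (x + r * y) + b * y ^+ 2).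
  transitivity ((a * n%:Z) * (x + r * y) + (b * n%:Z) * y ^+ 2); last by ring.
  by rewrite -ea -eb; ring.
case/dvdzP=> c ec.
have xn' : x ^+ 2 < n%:Z.
  rewrite lt_neqAle xn andbT; apply/eqP => xn'.
  have := @squarefree_nonsquare n x 1 sqn n_gt1; rewrite expr1n mulr1 => /(_ xn').
  by move/eqP; rewrite oner_eq0.
have x2 := sqr_ge0 x; have y2 := sqr_ge0 y.
have pos : 0 < x ^+ 2 + k%:Z * y ^+ 2.
  case/orP: xy0 => h; move: h; rewrite -sqrf_eq0; move: (x ^+ 2) (y ^+ 2) x2 y2; nia.
have [c1|[c2 k2]] : c = 1 \/ c = 2 /\ k = 2%N.
  by clear - ec xn' yn x2 y2 pos k12 n_gt1; move: (x ^+ 2) (y ^+ 2) ec xn' yn x2 y2 pos; nia.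
  by exists x, y; rewrite ec c1 mul1r.
(* If k = c = 2, then x is even, and dividing by 2 exchanges the variables: n = y^2 + 2 (x /
   2)^2. *)
have /dvdzP[x' ex] : (2%:Z %| x)%Z.
  rewrite -Euclid_dvdz_sqr //; apply/dvdzP; exists (n%:Z - y ^+ 2).
  by move: ec; rewrite c2 k2 => /(canRL (addrK _)) ->; ring.
exists y, x'; move: ec; rewrite c2 k2 ex => ec.
have : 2%:Z * n%:Z = 2%:Z * (y ^+ 2 + 2%:Z * x' ^+ 2) by rewrite -ec; ring.
by move/(mulfI _); apply.
Qed.

Lemma sum_form_of_odd_logn k n : (k == 1%N) || (k == 2%N) ->
  (forall p, prime p -> odd p -> odd (logn p n) -> qres p (- k%:Z)) ->
  exists x y : int, n%:Z = x ^+ 2 + k%:Z * y ^+ 2.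
Proof.
move=> k12 qp; have [->|n_gt0] := posnP n; first by exists 0, 0; ring.
have [n0 [sq0 [j en]]] := squarefree_part_exists n_gt0.
have j_gt0 : (0 < j)%N by case: j en n_gt0 => // ->; rewrite muln0.
have [|x [y exy]] := sum_form_of_qres k12 sq0.
  apply: qres_squarefree => // p pp pn; have [->|op] := even_prime pp; first exact: qres2.
  apply: qp => //; rewrite en lognM ?expn_gt0 ?j_gt0 ?(squarefree_gt0 sq0) //.
  by rewrite (logn_squarefree pp) // lognX oddD oddM.
by exists (j%:Z * x), (j%:Z * y); rewrite en PoszM exy expnS expn1 PoszM; ring.
Qed.

(** * From local conditions to small values of a ternary form *)

Lemma prime_coprime_ndvd p x y : prime p -> coprime x y -> (p %| x)%N -> ~~ (p %| y)%N.
Proof.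
move=> pp cxy px; apply/negP => py.
by have := dvdn_gcd p x y; rewrite px py (eqP cxy) dvdn1; case: eqP pp => // ->.
Qed.

(* For squarefree b and M: e * b is a local norm from Q(sqrt(-M)) at all odd primes. *)
Definition legendre_data (M b : nat) (e : int) : Prop :=
  [/\ squarefree b,
      forall p, prime p -> odd p -> (p %| b)%N -> ~~ (p %| M)%N -> qres p (- M%:Z),
      forall p, prime p -> odd p -> (p %| M)%N -> ~~ (p %| b)%N -> qres p (e * b%:Z)
    & forall p, prime p -> odd p -> (p %| M)%N -> (p %| b)%N ->
        qres p (e * (b %/ p)%:Z * (M %/ p)%:Z)].

(** With g = gcd(M, b), Chinese remaindering collects the conditions at single primes into one for
    each of g, M' and b'. *)
Lemma legendre_data_factor M b e : squarefree M -> legendre_data M b e ->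
  exists g M' b' : nat,
    [/\ M = (g * M')%N, b = (g * b')%N, coprime g M', coprime g b' & coprime M' b'] /\
    [/\ qres g (e * b'%:Z * M'%:Z), qres M' (e * b%:Z) & qres b' (- M%:Z)].
Proof.
move=> sqM [sqb qb qM qg].
have M_gt0 := squarefree_gt0 sqM; have b_gt0 := squarefree_gt0 sqb.
have g_gt0 : (0 < gcdn M b)%N by rewrite gcdn_gt0 M_gt0.
have /dvdnP[M' eM] := dvdn_gcdl M b; have /dvdnP[b' eb] := dvdn_gcdr M b.
rewrite mulnC in eM; rewrite mulnC in eb.
set g := gcdn M b in g_gt0 eM eb.
have cgM : coprime g M' by apply: squarefree_coprime; rewrite -eM.
have cgb : coprime g b' by apply: squarefree_coprime; rewrite -eb.
have cMb : coprime M' b'.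
  by rewrite /coprime -(eqn_pmul2l g_gt0) muln_gcdr -eM -eb muln1.
exists g, M', b'; split; first by split.
(* The prime 2 imposes nothing: every integer is a square modulo 2. *)
have qres_odd n c : squarefree n ->
    (forall p, prime p -> odd p -> (p %| n)%N -> qres p c) -> qres n c.
  move=> sqn h; apply: qres_squarefree => // p pp pn.
  by have [->|op] := even_prime pp; [apply: qres2 | apply: h].
split.
- apply: qres_odd => [|p pp op pg]; first by apply: squarefree_dvd sqM; rewrite eM dvdn_mulr.
  have pM : (p %| M)%N by rewrite eM dvdn_mulr.
  have pb : (p %| b)%N by rewrite eb dvdn_mulr.
  (* (b / p)(M / p) is b' M' times the square of g / p, which is a unit modulo p. *)
  have pgp : ~~ (p%:Z %| (g %/ p)%:Z)%Z.
    rewrite dvdzE /=; apply/negP => pgp; have := squarefree_prime_sqr pp sqM.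
    by rewrite eM dvdn_mulr // -(divnK pg) expnS expn1 dvdn_mul.
  apply: (qres_sqr_cancel pp pgp); have := qg p pp op pM pb.
  by rewrite eb eM !(mulnC g) -!muln_divA // !PoszM; congr qres; ring.
- apply: qres_odd => [|p pp op pM']; first by apply: squarefree_dvd sqM; rewrite eM dvdn_mull.
  apply: qM => //; first by rewrite eM dvdn_mull.
  by rewrite eb Euclid_dvdM // negb_or !(@prime_coprime_ndvd _ M') // coprime_sym.
- apply: qres_odd => [|p pp op pb']; first by apply: squarefree_dvd sqb; rewrite eb dvdn_mull.
  apply: qb => //; first by rewrite eb dvdn_mull.
  by rewrite eM Euclid_dvdM // negb_or !(@prime_coprime_ndvd _ b') // coprime_sym.
Qed.

(** With x = g u, the form x^2 + M v^2 - e b w^2 is g times the one used here, to which the box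
    argument applies because g, M' and b' are pairwise coprime. *)
Lemma legendre_data_form M b e : squarefree M -> legendre_data M b e ->
  exists g M' b' : nat, exists u v w : int,
    [/\ M = (g * M')%N, b = (g * b')%N, coprime g M', coprime g b' & coprime M' b'] /\
    [/\ qres g (e * b'%:Z * M'%:Z), qres M' (e * b%:Z) & qres b' (- M%:Z)] /\
    [/\ [|| u != 0, v != 0 | w != 0], u ^+ 2 <= M'%:Z * b'%:Z, v ^+ 2 <= g%:Z * b'%:Z,
        w ^+ 2 <= M%:Z
      & (g%:Z * M'%:Z * b'%:Z %| g%:Z * u ^+ 2 + M'%:Z * v ^+ 2 - e * b'%:Z * w ^+ 2)%Z].
Proof.
move=> sqM hd; have [g [M' [b' [[eM eb cgM cgb cMb] [qg qM qb]]]]] := legendre_data_factor sqM hd.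
have sqb : squarefree b by case: hd.
have M_gt0 := squarefree_gt0 sqM; have b_gt0 := squarefree_gt0 sqb.
have /andP[g_gt0 M'_gt0] : (0 < g)%N && (0 < M')%N by rewrite -muln_gt0 -eM.
have b'_gt0 : (0 < b')%N by move: b_gt0; rewrite eb muln_gt0 => /andP[].
case: (qg) => r1 h1; case: (qM) => r2 h2; case: (qb) => r3 h3.
have [||||u [v [w]]] := @legendre_pigeonhole g M' b' (- (e * b'%:Z)) r1 r2 r3 g_gt0 M'_gt0 b'_gt0 cgM cgb cMb.
- by rewrite rpredN dvdz_mull.
- by move: h1; congr (_ %| _)%Z; ring.
- by move: h2; rewrite eb PoszM; congr (_ %| _)%Z; ring.
- by move: h3; rewrite eM PoszM opprK.
rewrite !PoszM => h; exists g, M', b', u, v, w; do 2!split=> //.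
by move: h; rewrite mulNr [M in _ <= M%:Z]eM PoszM.
Qed.

(** The small value is k g M' b' with k in {0, 1, 2}. For k = 0 it is the desired equation, and for
    k = 1 Legendre's identity turns it into one. For k = 2 the bounds on u and v are attained, which
    makes M b'^2 a square. *)
Lemma legendre_norm M b : squarefree M -> (1 < M)%N -> legendre_data M b 1 ->
  exists (x y : int) (W : nat), [/\ (0 < W)%N, (W <= 2 * M)%N
    & x ^+ 2 + M%:Z * y ^+ 2 = b%:Z * W%:Z ^+ 2].
Proof.
move=> sqM M_gt1 hd.
have [g [M' [b' [u [v [w [[eM eb cgM cgb cMb] [_ [nz hu hv hw]]]]]]]]] := legendre_data_form sqM hd.
have sqb : squarefree b by case: hd.
have M_gt0 := squarefree_gt0 sqM; have b_gt0 := squarefree_gt0 sqb.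
have /andP[g_gt0 M'_gt0] : (0 < g)%N && (0 < M')%N by rewrite -muln_gt0 -eM.
have b'_gt0 : (0 < b')%N by move: b_gt0; rewrite eb muln_gt0 => /andP[].
have gM : M%:Z = g%:Z * M'%:Z by rewrite eM PoszM.
have gb : b%:Z = g%:Z * b'%:Z by rewrite eb PoszM.
case/dvdzP=> k; rewrite mul1r => ek.
have u2 := sqr_ge0 u; have v2 := sqr_ge0 v; have w2 := sqr_ge0 w.
have D_gt0 : 0 < g%:Z * M'%:Z * b'%:Z by rewrite !mulr_gt0 // ltz_nat.
have wM : w ^+ 2 < M%:Z.
  rewrite lt_neqAle hw andbT; apply/eqP => wM.
  by have := @squarefree_nonsquare M w 1 sqM M_gt1; rewrite expr1n mulr1 => /(_ wM).
have gu : g%:Z * u ^+ 2 <= g%:Z * M'%:Z * b'%:Z by rewrite -mulrA ler_wpM2l.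
have Mv : M'%:Z * v ^+ 2 <= g%:Z * M'%:Z * b'%:Z.
  by rewrite [g%:Z * _]mulrC -mulrA ler_wpM2l.
have bw : b'%:Z * w ^+ 2 < g%:Z * M'%:Z * b'%:Z.
  by rewrite -gM mulrC ltr_pM2r // ltz_nat.
have gu0 : 0 <= g%:Z * u ^+ 2 by rewrite mulr_ge0.
have Mv0 : 0 <= M'%:Z * v ^+ 2 by rewrite mulr_ge0.
have bw0 : 0 <= b'%:Z * w ^+ 2 by rewrite mulr_ge0.
have [k0|[k1|k2]] : k = 0 \/ k = 1 \/ k = 2.
- by clear -gu Mv bw gu0 Mv0 bw0 ek D_gt0; nia.
- exists (g%:Z * u), v, `|w|%N; split.
  + rewrite absz_gt0; apply/eqP => w0; move: nz; rewrite w0 eqxx orbF.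
    move: ek; rewrite k0 w0 expr0n mulr0 mul0r subr0 => ek.
    have /eqP : g%:Z * u ^+ 2 = 0 by clear -ek gu0 Mv0; lia.
    have /eqP : M'%:Z * v ^+ 2 = 0 by clear -ek gu0 Mv0; lia.
    by rewrite !mulf_eq0 ?orbb !eqz_nat !eqn0Ngt g_gt0 M'_gt0 /= => -> ->.
  + by clear -wM; nia.
  + rewrite abszE gM gb real_normK ?num_real //.
    move: ek; rewrite k0 mul0r => /eqP; rewrite subr_eq0 => /eqP h.
    transitivity (g%:Z * (g%:Z * u ^+ 2 + M'%:Z * v ^+ 2)); first by ring.
    by rewrite h; ring.
(* Here g u + v sqrt(-M) has norm b (w^2 + M); its product with w + sqrt(-M) has norm b (w^2 +
   M)^2. *)
- exists (g%:Z * u * w - M%:Z * v), (g%:Z * u + v * w), (absz (w ^+ 2 + M%:Z)); split.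
  + by clear -w2 M_gt0; lia.
  + by clear -w2 wM; lia.
  + rewrite gez0_abs; last by rewrite addr_ge0.
    have -> : (g%:Z * u * w - M%:Z * v) ^+ 2 + M%:Z * (g%:Z * u + v * w) ^+ 2 =
      ((g%:Z * u) ^+ 2 + M%:Z * v ^+ 2) * (w ^+ 2 + M%:Z) by ring.
    have -> : (g%:Z * u) ^+ 2 + M%:Z * v ^+ 2 = b%:Z * (w ^+ 2 + M%:Z).
      move: ek; rewrite k1 mul1r gM gb => /eqP; rewrite subr_eq => /eqP h.
      transitivity (g%:Z * (g%:Z * u ^+ 2 + M'%:Z * v ^+ 2)); first by ring.
      by rewrite h; ring.
    by ring.
- have ub : u ^+ 2 = M'%:Z * b'%:Z.
    have : g%:Z * u ^+ 2 = g%:Z * (M'%:Z * b'%:Z) by clear -ek k2 gu Mv bw0; nia.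
    by apply: mulfI; rewrite eqz_nat -lt0n.
  have vb : v ^+ 2 = g%:Z * b'%:Z.
    have : M'%:Z * v ^+ 2 = M'%:Z * (g%:Z * b'%:Z) by clear -ek k2 gu Mv bw0; nia.
    by apply: mulfI; rewrite eqz_nat -lt0n.
  have /(squarefree_nonsquare sqM M_gt1)/eqP : (u * v) ^+ 2 = M%:Z * b'%:Z ^+ 2.
    by rewrite exprMn ub vb gM; ring.
  by rewrite eqz_nat eqn0Ngt b'_gt0.
Qed.

Lemma qres_dvd p n c : (p %| n)%N -> qres n c -> qres p c.
Proof. by move=> pn [s ns]; exists s; apply: dvdz_trans ns; rewrite dvdzE. Qed.

(** Serves the primes dividing both M and k M - w^2. The relation forces p | v; dividing it by p and
    cancelling A / p, a unit since A is squarefree, gives u^2 = k B C modulo p, and -B C is a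
    residue. *)
Lemma qres_neg_ramified p k (A B C : nat) (u v w : int) :
  prime p -> squarefree A -> (p %| A)%N -> ~~ (p %| B)%N -> ~~ (p %| C)%N ->
  (p%:Z %| w)%Z -> qres p (- (B%:Z * C%:Z)) ->
  C%:Z * (k%:Z * (A%:Z * B%:Z) - w ^+ 2) = A%:Z * u ^+ 2 + B%:Z * v ^+ 2 ->
  qres p (- k%:Z).
Proof.
move=> pp sqA /dvdnP[A1 eA] pB pC /dvdzP[w1 ew] qBC h.
have p0 : p%:Z != 0 by rewrite eqz_nat -lt0n prime_gt0.
have pA1 : ~~ (p %| A1)%N.
  apply/negP => pA1; have := squarefree_prime_sqr pp sqA.
  by rewrite eA expnS expn1 dvdn_mul.
have /dvdzP[v1 ev] : (p%:Z %| v)%Z.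
  have : (p%:Z %| B%:Z * v ^+ 2)%Z.
    apply/dvdzP; exists (C%:Z * (k%:Z * (A1%:Z * B%:Z) - w1 ^+ 2 * p%:Z) - A1%:Z * u ^+ 2).
    rewrite (_ : B%:Z * _ = C%:Z * (k%:Z * (A%:Z * B%:Z) - w ^+ 2) - A%:Z * u ^+ 2).
      by rewrite eA ew PoszM; ring.
    by rewrite h; ring.
  by rewrite Euclid_dvdz // Euclid_dvdz_sqr // dvdzE /= (negbTE pB).
have quk : qres p (k%:Z * (B%:Z * C%:Z)).
  exists u.
  have : (p%:Z %| A1%:Z * (u ^+ 2 - k%:Z * (B%:Z * C%:Z)))%Z.
    apply/dvdzP; exists (- C%:Z * w1 ^+ 2 - B%:Z * v1 ^+ 2).
    apply: (mulfI p0); move: h; rewrite eA ew ev PoszM => h.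
    apply/eqP; rewrite -subr_eq0.
    rewrite (_ : _ - _ = - (C%:Z * (k%:Z * (A1%:Z * p%:Z * B%:Z) - (w1 * p%:Z) ^+ 2) -
       (A1%:Z * p%:Z * u ^+ 2 + B%:Z * (v1 * p%:Z) ^+ 2))); last by ring.
    by rewrite h subrr oppr0.
  by rewrite Euclid_dvdz // dvdzE /= (negbTE pA1).
apply: (@qres_sqr_cancel _ _ (B%:Z * C%:Z)) => //.
  by rewrite Euclid_dvdz // negb_or !dvdzE /= pB.
by rewrite (_ : _ * _ = - (B%:Z * C%:Z) * (k%:Z * (B%:Z * C%:Z))); [apply: qres_mul | ring].
Qed.

(** The small value is now k g M' b' with k = 1 or 2, so b' (k M - w^2) = g u^2 + M' v^2. It
    suffices to write k M - w^2 as x^2 + k y^2, for which -k must be a residue at the odd primes of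
    odd exponent. *)
Lemma legendre_three_squares M b : squarefree M -> (1 < M)%N -> legendre_data M b (-1) ->
  exists x y z : int, M%:Z = x ^+ 2 + y ^+ 2 + z ^+ 2.
Proof.
move=> sqM M_gt1 hd.
have [g [M' [b' [u [v [w [[eM eb cgM cgb cMb] [[qg qM qb] [nz hu hv hw]]]]]]]]] := legendre_data_form sqM hd.
have sqb : squarefree b by case: hd.
have M_gt0 := squarefree_gt0 sqM; have b_gt0 := squarefree_gt0 sqb.
have /andP[g_gt0 M'_gt0] : (0 < g)%N && (0 < M')%N by rewrite -muln_gt0 -eM.
have b'_gt0 : (0 < b')%N by move: b_gt0; rewrite eb muln_gt0 => /andP[].
have gM : M%:Z = g%:Z * M'%:Z by rewrite eM PoszM.
have gb : b%:Z = g%:Z * b'%:Z by rewrite eb PoszM.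
case/dvdzP=> k; rewrite !mulN1r mulNr opprK => ek.
have u2 := sqr_ge0 u; have v2 := sqr_ge0 v; have w2 := sqr_ge0 w.
have D_gt0 : 0 < g%:Z * M'%:Z * b'%:Z by rewrite !mulr_gt0 // ltz_nat.
have wM : w ^+ 2 < M%:Z.
  rewrite lt_neqAle hw andbT; apply/eqP => wM.
  by have := @squarefree_nonsquare M w 1 sqM M_gt1; rewrite expr1n mulr1 => /(_ wM).
have gu : g%:Z * u ^+ 2 <= g%:Z * M'%:Z * b'%:Z by rewrite -mulrA ler_wpM2l.
have Mv : M'%:Z * v ^+ 2 <= g%:Z * M'%:Z * b'%:Z.
  by rewrite [g%:Z * _]mulrC -mulrA ler_wpM2l.
have bw : b'%:Z * w ^+ 2 < g%:Z * M'%:Z * b'%:Z.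
  by rewrite -gM mulrC ltr_pM2r // ltz_nat.
have gu0 : 0 <= g%:Z * u ^+ 2 by rewrite mulr_ge0.
have Mv0 : 0 <= M'%:Z * v ^+ 2 by rewrite mulr_ge0.
have bw0 : 0 <= b'%:Z * w ^+ 2 by rewrite mulr_ge0.
have F_gt0 : 0 < g%:Z * u ^+ 2 + M'%:Z * v ^+ 2 + b'%:Z * w ^+ 2.
  have sqr_gt0 (n : nat) (x : int) : (0 < n)%N -> x != 0 -> 0 < n%:Z * x ^+ 2.
    by move=> n_gt0 x0; rewrite mulr_gt0 ?ltz_nat // lt0r sqrf_eq0 x0 sqr_ge0.
  case/or3P: nz => h0.
  - by have := sqr_gt0 g u g_gt0 h0; clear -Mv0 bw0; lia.
  - by have := sqr_gt0 M' v M'_gt0 h0; clear -gu0 bw0; lia.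
  - by have := sqr_gt0 b' w b'_gt0 h0; clear -Mv0 gu0; lia.
have [K [eK k12]] : exists K : nat, k = K%:Z /\ (K == 1%N) || (K == 2%N).
  have : k = 1 \/ k = 2 by clear -gu Mv bw gu0 Mv0 bw0 ek D_gt0 F_gt0; nia.
  by case=> ->; [exists 1%N | exists 2%N].
have delta : b'%:Z * (K%:Z * M%:Z - w ^+ 2) = g%:Z * u ^+ 2 + M'%:Z * v ^+ 2.
  apply: (addIr (b'%:Z * w ^+ 2)); rewrite ek eK gM; ring.
have d_ge0 : 0 <= K%:Z * M%:Z - w ^+ 2 by clear -wM k12; nia.
have [|x [y exy]] := @sum_form_of_odd_logn K (absz (K%:Z * M%:Z - w ^+ 2)%R) k12.
  move=> p pp op od.
  have pk : ~~ (p %| K)%N.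
    by case/orP: k12 => /eqP ->; rewrite ?dvdn1 ?dvdn_prime2 //; apply/eqP => p2; rewrite p2 in pp op.
  have pd : (p%:Z %| K%:Z * M%:Z - w ^+ 2)%Z.
    rewrite dvdzE /= -[p]expn1 pfactor_dvdn //; first by case: logn od.
    by case: absz od => //; rewrite logn0.
  have [pM|pM] := boolP (p %| M)%N.
    have pw : (p%:Z %| w)%Z.
      have pKM : (p%:Z %| K%:Z * M%:Z)%Z by apply: dvdz_mull; rewrite dvdzE.
      by rewrite -Euclid_dvdz_sqr // -rpredN -(rpredDl _ pKM).
    move: (pM); rewrite eM Euclid_dvdM // => /orP[pg|pM'].
      apply: (@qres_neg_ramified p K g M' b' u v w) => //.
      - by apply: squarefree_dvd sqM; rewrite eM dvdn_mulr.
      - exact: prime_coprime_ndvd cgM _.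
      - exact: prime_coprime_ndvd cgb _.
      - by move: (qres_dvd pg qg); congr qres; ring.
      - by rewrite -gM.
    apply: (@qres_neg_ramified p K M' g b' v u w) => //.
    - by apply: squarefree_dvd sqM; rewrite eM dvdn_mull.
    - by apply: prime_coprime_ndvd pM'; rewrite // coprime_sym.
    - exact: prime_coprime_ndvd cMb _.
    - by move: (qres_dvd pM' qM); rewrite gb; congr qres; ring.
    - by rewrite [M'%:Z * g%:Z]mulrC -gM delta addrC.
  (* If p does not divide b', it has odd exponent in b (k M - w^2), the norm of g u + v sqrt(-M).
     Once -M is a residue, so is -k, because k M = w^2 modulo p. *)
  have qnM : qres p (- M%:Z).
    have [pb|pb] := boolP (p %| b')%N; first exact: qres_dvd qb.
    apply: (@qres_neg_of_odd_logn _ _ (g%:Z * u) v) => //.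
    rewrite (_ : _ + _ = (g * b')%N%:Z * (K%:Z * M%:Z - w ^+ 2)).
      rewrite abszM lognM ?muln_gt0 ?g_gt0 ?b'_gt0 //; last by case: absz od => //; rewrite logn0.
      rewrite oddD od absz_nat lognM // !logn_coprime //.
        by rewrite prime_coprime.
      by rewrite prime_coprime //; apply: contra pM; rewrite eM; apply: dvdn_mulr.
    by rewrite PoszM -mulrA delta gM; ring.
  have qKM : qres p (K%:Z * M%:Z) by apply: (qres_cong _ (qres_sqr p w)); rewrite -rpredN opprB.
  apply: (@qres_sqr_cancel _ _ M%:Z) => //.
  by rewrite (_ : _ * _ = - M%:Z * (K%:Z * M%:Z)); [apply: qres_mul | ring].
rewrite gez0_abs // in exy.
case/orP: k12 => /eqP K12; rewrite K12 in exy.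
  by exists w, x, y; move: exy; rewrite !mul1r => /eqP; rewrite subr_eq => /eqP ->; ring.
(* For k = 2, 2 M = w^2 + x^2 + 2 y^2, and (w^2 + x^2) / 2 is the sum of the squares of (w + x) / 2
   and (w - x) / 2. *)
have par : (2%:Z %| w - x)%Z.
  have : (2%:Z %| (w - x) ^+ 2)%Z.
    apply/dvdzP; exists (M%:Z - y ^+ 2 - w * x).
    apply/eqP; rewrite -subr_eq0; apply/eqP.
    transitivity (- (2%:Z * M%:Z - w ^+ 2 - (x ^+ 2 + 2%:Z * y ^+ 2))); first by ring.
    by rewrite exy subrr oppr0.
  by rewrite Euclid_dvdz_sqr.
case/dvdzP: par => a ea; exists (x + a), a, y.
have ew : w = x + a * 2%:Z by rewrite -ea; ring.
apply: (@mulfI _ 2%:Z) => //.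
apply/eqP; rewrite -subr_eq0; apply/eqP.
transitivity (2%:Z * M%:Z - w ^+ 2 - (x ^+ 2 + 2%:Z * y ^+ 2)); first by rewrite ew; ring.
by rewrite exy subrr.
Qed.

(** * Norms from Z[sqrt(-M)] *)

(** The pair (a, b) stands for a + b sqrt(-M). The alias records M and keeps its product apart from
    the componentwise one. *)
Definition zsqrt (M : nat) : Type := (int * int)%type.

HB.instance Definition _ M := GRing.Zmodule.copy (zsqrt M) (int * int)%type.

Section ZsqrtRing.
Variable M : nat.
Implicit Types x y z : zsqrt M.

Definition zsqrt_mul x y : zsqrt M :=
  (x.1 * y.1 - M%:Z * (x.2 * y.2), x.1 * y.2 + x.2 * y.1).

Lemma zsqrt_mulA : associative zsqrt_mul.
Proof. by case=> a b [c d] [e f]; congr pair => /=; ring. Qed.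
Lemma zsqrt_mulC : commutative zsqrt_mul.
Proof. by case=> a b [c d]; congr pair => /=; ring. Qed.
Lemma zsqrt_mul1 : left_id ((1, 0) : zsqrt M) zsqrt_mul.
Proof. by case=> a b; congr pair => /=; ring. Qed.
Lemma zsqrt_mulD : left_distributive zsqrt_mul +%R.
Proof. by case=> a b [c d] [e f]; congr pair => /=; ring. Qed.
Lemma zsqrt_1neq0 : ((1, 0) : zsqrt M) != 0.
Proof. by []. Qed.

HB.instance Definition _ := GRing.Zmodule_isComNzRing.Build (zsqrt M)
  zsqrt_mulA zsqrt_mulC zsqrt_mul1 zsqrt_mulD zsqrt_1neq0.

Definition zsqrt_norm x : int := x.1 ^+ 2 + M%:Z * x.2 ^+ 2.
Definition zsqrt_conj x : zsqrt M := (x.1, - x.2).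

Lemma zsqrt_normM : {morph zsqrt_norm : x y / x * y}.
Proof. by case=> a b [c d]; rewrite /zsqrt_norm /=; ring. Qed.
Lemma zsqrt_norm1 : zsqrt_norm 1 = 1.
Proof. by rewrite /zsqrt_norm /= expr1n expr0n mulr0 addr0. Qed.
Lemma zsqrt_normX x n : zsqrt_norm (x ^+ n) = zsqrt_norm x ^+ n.
Proof. by elim: n => [|n IH]; rewrite ?zsqrt_norm1 // !exprS zsqrt_normM IH. Qed.
Lemma zsqrt_conjM : {morph zsqrt_conj : x y / x * y}.
Proof. by case=> a b [c d]; congr pair => /=; ring. Qed.
Lemma zsqrt_conjX x n : zsqrt_conj (x ^+ n) = zsqrt_conj x ^+ n.
Proof.
elim: n => [|n IH]; last by rewrite !exprS zsqrt_conjM IH.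
by congr pair; rewrite oppr0.
Qed.
Lemma zsqrt_norm_conj x : zsqrt_norm (zsqrt_conj x) = zsqrt_norm x.
Proof. by rewrite /zsqrt_norm /= sqrrN. Qed.
Lemma zsqrt_mul_conj x : x * zsqrt_conj x = (zsqrt_norm x, 0).
Proof. by case: x => a b; congr pair; rewrite /zsqrt_norm /=; ring. Qed.

Lemma zsqrt_norm_gt0 x : (0 < M)%N -> x != 0 -> 0 < zsqrt_norm x.
Proof.
case: x => a b M_gt0; rewrite /zsqrt_norm -pair_eqE /= negb_and => ab0.
have a2 := sqr_ge0 a; have b2 := sqr_ge0 b.
have Mb : 0 <= M%:Z * b ^+ 2 by rewrite mulr_ge0.
case/orP: ab0 => h.
  by rewrite ltr_pwDl // lt0r sqrf_eq0 h.
by rewrite ltr_wpDl // mulr_gt0 ?ltz_nat // lt0r sqrf_eq0 h.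
Qed.

Definition zsqrt_prim x : zsqrt M := ((x.1 %/ gcdz x.1 x.2)%Z, (x.2 %/ gcdz x.1 x.2)%Z).

Lemma zsqrt_primP x : x != 0 ->
  exists2 d : int, 0 < d & [/\ x.1 = d * (zsqrt_prim x).1, x.2 = d * (zsqrt_prim x).2
    & coprimez (zsqrt_prim x).1 (zsqrt_prim x).2].
Proof.
case: x => a b; rewrite -pair_eqE negb_and /= => /coprime_decomp[d [a' [b' [d0 ea eb cab]]]].
have gE : gcdz a b = d by rewrite ea eb -mulz_gcdr (eqP cab) mulr1 gtz0_abs.
have aE : (a %/ d)%Z = a' by rewrite ea mulKz ?gt_eqF.
have bE : (b %/ d)%Z = b' by rewrite eb mulKz ?gt_eqF.
by exists d => //; rewrite /zsqrt_prim /= gE aE bE.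
Qed.

End ZsqrtRing.

(** * Primitive elements and the prime factors of their norms *)

(** These p ramify; the condition on M modulo 4 makes 2 one of them. If p | M, then p | x but not y,
    and p^2 | n would give p^2 | M. Otherwise p = 2, M = 1 modulo 4, x and y are odd, and n = 2
    modulo 4. *)
Lemma ramified_logn_le1 M (x y : int) n p :
  squarefree M -> (M %% 4 == 1)%N || (M %% 4 == 2)%N -> (0 < n)%N -> prime p ->
  coprimez x y -> x ^+ 2 + M%:Z * y ^+ 2 = n%:Z -> ~~ odd p || (p %| M)%N ->
  (logn p n <= 1)%N.
Proof.
move=> sqM M4 n_gt0 pp cxy en ram; rewrite leqNgt -pfactor_dvdn //; apply/negP => p2n.
have pn : (p %| n)%N by apply: dvdn_trans p2n; rewrite expnS dvdn_mulr.
have pN : (p%:Z %| x ^+ 2 + M%:Z * y ^+ 2)%Z by rewrite en dvdzE.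
have [pM|pM] := boolP (p %| M)%N.
  have px : (p%:Z %| x)%Z.
    by move: pN; rewrite rpredDr ?Euclid_dvdz_sqr // dvdz_mulr // dvdzE.
  have py : ~~ (p%:Z %| y)%Z by apply/negP; exact: coprimez_prime_dvd cxy px.
  have /negP := squarefree_prime_sqr pp sqM; apply.
  rewrite -[X in (X %| _)%N]/(absz (p ^ 2)%N) -[M]absz_nat -dvdzE.
  have cop : coprimez (p ^ 2)%N (y ^+ 2).
    by rewrite coprimezE abszX coprimeXl // coprimeXr // prime_coprime // -[p]absz_nat -dvdzE.
  rewrite -(Gauss_dvdzl _ cop) -(rpredDl (x := x ^+ 2)) ?en ?dvdzE //=.
  by rewrite abszX dvdn_exp2r // -[p]absz_nat -dvdzE.
move: ram; rewrite (negbTE pM) orbF => op.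
have p2 : p = 2%N by case: (even_prime pp) => // op'; rewrite op' in op.
have [py _] := qres_neg_of_dvd pp cxy pM pN.
have px : ~~ (p%:Z %| x)%Z.
  apply: contra py => px; move: pN; rewrite rpredDl ?Euclid_dvdz_sqr //.
  by rewrite Euclid_dvdz // Euclid_dvdz_sqr // dvdzE /= (negbTE pM).
rewrite p2 in px py p2n pM.
have [a ex] : exists a, x = 2 * a + 1 by exists (x %/ 2)%Z; move: px; clear; lia.
have [b ey] : exists b, y = 2 * b + 1 by exists (y %/ 2)%Z; move: py; clear; lia.
have [c eM] : exists c : nat, M = (4 * c + 1)%N.
  by exists (M %/ 4)%N; move: M4 pM; clear; lia.
have : n%:Z = 4 * (a ^+ 2 + a + c%:Z * (2 * b + 1) ^+ 2 + b ^+ 2 + b) + 2.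
  by rewrite -en ex ey eM PoszD PoszM; ring.
by move: (_ + b) p2n; clear; lia.
Qed.

(* The norm of a primitive element, together with the choice at each odd unramified
   prime divisor of the root of -M it reduces to, determines the element up to sign. *)
Lemma primitive_rep_unique M (s : nat -> int) (x y x' y' : int) n :
  squarefree M -> (1 < M)%N -> (M %% 4 == 1)%N || (M %% 4 == 2)%N -> (0 < n)%N ->
  (forall p, prime p -> qres p (- M%:Z) -> (p%:Z %| s p ^+ 2 + M%:Z)%Z) ->
  coprimez x y -> coprimez x' y' ->
  x ^+ 2 + M%:Z * y ^+ 2 = n%:Z -> x' ^+ 2 + M%:Z * y' ^+ 2 = n%:Z ->
  (forall p, prime p -> (p %| n)%N -> (p%:Z %| x + s p * y)%Z = (p%:Z %| x' + s p * y')%Z) ->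
  x * y' = x' * y.
Proof.
move=> sqM M_gt1 M4 n_gt0 sP cxy cxy' en en' hs.
have ram_logn p : prime p -> (p %| n)%N -> ~~ odd p || (p %| M)%N -> logn p n = 1%N.
  move=> pp pn ram; apply/eqP; rewrite eqn_leq -pfactor_dvdn // expn1 pn andbT.
  exact: ramified_logn_le1 pp cxy en ram.
(* One element times the conjugate of the other has norm n^2, and its sqrt(-M)-coordinate is x y' -
   x' y up to sign; a nonzero multiple of n there would make the norm at least M n^2 > n^2. *)
suff /dvdzP[B eB] : (n%:Z %| x * y' - x' * y)%Z.
  have : (x * x' + M%:Z * (y * y')) ^+ 2 + M%:Z * (B * n%:Z) ^+ 2 = n%:Z ^+ 2.
    rewrite [RHS]expr2 -[in RHS]en -[in LHS]eB.
    transitivity ((x ^+ 2 + M%:Z * y ^+ 2) * (x' ^+ 2 + M%:Z * y' ^+ 2)); first by ring.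
    by rewrite en' en.
  move/eqP: eB; rewrite subr_eq => /eqP eB h.
  have B0 : B = 0.
    apply/eqP; apply: contraT; rewrite -sqrf_eq0 => B0.
    have := sqr_ge0 (x * x' + M%:Z * (y * y')); move: h; rewrite exprMn.
    have B1 : 1 <= B ^+ 2 by have := sqr_ge0 B; move: B0; clear; lia.
    have n1 : 1 <= n%:Z ^+ 2 by rewrite exprn_ege1.
    have Bn : n%:Z ^+ 2 <= B ^+ 2 * n%:Z ^+ 2 by rewrite ler_peMl // (le_trans _ n1).
    have MBn : 2%:Z * (B ^+ 2 * n%:Z ^+ 2) <= M%:Z * (B ^+ 2 * n%:Z ^+ 2).
      by rewrite ler_wpM2r // mulr_ge0 ?sqr_ge0.
    by move: (_ ^+ 2) (B ^+ 2 * _) (M%:Z * _) Bn MBn n1 => *; lia.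
  by rewrite eB B0 mul0r add0r.
rewrite dvdzE /=; apply/dvdn_partP => // p; rewrite mem_primes => /and3P[pp _ pn].
have pN : (p%:Z %| x ^+ 2 + M%:Z * y ^+ 2)%Z by rewrite en dvdzE.
have pN' : (p%:Z %| x' ^+ 2 + M%:Z * y' ^+ 2)%Z by rewrite en' dvdzE.
rewrite p_part -[X in (X %| _)%N]/(absz (p ^ logn p n)%N) -dvdzE.
have [ram|] := boolP (~~ odd p || (p %| M)%N).
  rewrite ram_logn // expn1.
  have [pM|pM] := boolP (p %| M)%N.
    have px (a b : int) : (p%:Z %| a ^+ 2 + M%:Z * b ^+ 2)%Z -> (p%:Z %| a)%Z.
      by rewrite rpredDr ?Euclid_dvdz_sqr // dvdz_mulr // dvdzE.
    by rewrite rpredB // dvdz_mulr // (px _ _ pN, px _ _ pN').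
  move: ram; rewrite (negbTE pM) orbF => op.
  have p2 : p = 2%N by case: (even_prime pp) => // op'; rewrite op' in op.
  have [py _] := qres_neg_of_dvd pp cxy pM pN.
  have [py' _] := qres_neg_of_dvd pp cxy' pM pN'.
  have px : ~~ (p%:Z %| x)%Z.
    apply: contra py => px; move: pN; rewrite rpredDl ?Euclid_dvdz_sqr //.
    by rewrite Euclid_dvdz // Euclid_dvdz_sqr // dvdzE /= (negbTE pM).
  have px' : ~~ (p%:Z %| x')%Z.
    apply: contra py' => px'; move: pN'; rewrite rpredDl ?Euclid_dvdz_sqr //.
    by rewrite Euclid_dvdz // Euclid_dvdz_sqr // dvdzE /= (negbTE pM).
  move: px py px' py'; rewrite p2; clear; nia.
rewrite negb_or negbK => /andP[op pM].
have [py qM] := qres_neg_of_dvd pp cxy pM pN.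
have [py' _] := qres_neg_of_dvd pp cxy' pM pN'.
have ps : ~~ (p%:Z %| s p)%Z.
  apply/negP => ps; have := sP p pp qM; rewrite rpredDl ?Euclid_dvdz_sqr //.
  by rewrite dvdzE /= (negbTE pM).
(* Both elements reduce to the same root, so this sum is 2 s y y' up to sign modulo p, a unit; and
   (x y' - x' y)(x y' + x' y) = n (y'^2 - y^2). *)
have sums : ~~ (p%:Z %| x * y' + x' * y)%Z.
  have split (a b : int) : (p%:Z %| a ^+ 2 + M%:Z * b ^+ 2)%Z ->
      (p%:Z %| a + s p * b)%Z || (p%:Z %| a - s p * b)%Z.
    move=> pab; rewrite -Euclid_dvdz //.
    rewrite (_ : _ * _ = (a ^+ 2 + M%:Z * b ^+ 2) - (s p ^+ 2 + M%:Z) * b ^+ 2); last by ring.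
    by rewrite rpredB // dvdz_mulr // sP.
  have two : ~~ (p%:Z %| 2%:Z * s p * (y * y'))%Z.
    rewrite !Euclid_dvdz // !negb_or ps py py' !andbT dvdzE /= dvdn_prime2 //.
    by apply/eqP => p2; rewrite p2 in op.
  apply: contra two => psum.
  have [h|h] := boolP (p%:Z %| x + s p * y)%Z.
    have h' := h; rewrite hs // in h'.
    rewrite (_ : _ * _ * _ = (x + s p * y) * y' + (x' + s p * y') * y - (x * y' + x' * y)); last by ring.
    by rewrite rpredB // rpredD // dvdz_mulr.
  have h' := h; rewrite hs // in h'.
  move: (split _ _ pN) (split _ _ pN'); rewrite (negbTE h) (negbTE h') /= => {}h {}h'.
  rewrite (_ : _ * _ * _ = (x * y' + x' * y) - ((x - s p * y) * y' + (x' - s p * y') * y)); last by ring.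
  by rewrite rpredB // rpredD // dvdz_mulr.
rewrite -(@Gauss_dvdzl _ _ (x * y' + x' * y)); last first.
  by rewrite coprimezE absz_nat coprimeXl // prime_coprime // -[p]absz_nat -dvdzE.
rewrite (_ : _ * _ = (y' ^+ 2 - y ^+ 2) * n%:Z).
  by rewrite dvdz_mull // dvdzE /= pfactor_dvdnn.
transitivity ((x ^+ 2 + M%:Z * y ^+ 2) * y' ^+ 2 - (x' ^+ 2 + M%:Z * y' ^+ 2) * y ^+ 2).
  by ring.
by rewrite en en'; ring.
Qed.

Definition split_primes (M B : nat) : {set 'I_B.+1} :=
  [set p : 'I_B.+1 | [&& prime p, odd p, ~~ (p %| M)%N & qresb p (- M%:Z)]].

(** Fixing one root per prime lets a single bit record which prime above p divides an element. *)
Lemma root_choice (c : int) : exists s : nat -> int,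
  forall p, prime p -> qres p c -> (p%:Z %| s p ^+ 2 - c)%Z.
Proof.
exists (fun p => if [pick s : 'I_p | (p%:Z %| s%:Z ^+ 2 - c)%Z] is Some s then s%:Z else 0).
move=> p pp /qresP-/(_ (prime_gt0 pp)) /existsP[s hs].
by case: pickP => [//|/(_ s)]; rewrite hs.
Qed.

(** * Multiplicative relations between norms *)

Section PowerProducts.
Variables (M k : nat) (z : 'I_k -> zsqrt M).
Implicit Types e f : 'I_k -> nat.

Definition zprod e : zsqrt M := \prod_i z i ^+ e i.

Lemma zsqrt_norm_zprod e : zsqrt_norm (zprod e) = \prod_i zsqrt_norm (z i) ^+ e i.
Proof.
rewrite /zprod (big_morph _ (@zsqrt_normM M) (zsqrt_norm1 M)).
by apply: eq_bigr => i _; rewrite zsqrt_normX.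
Qed.

Lemma zprod_half e : zprod e = zprod (fun i => (e i)./2) ^+ 2 * zprod (fun i => odd (e i)).
Proof.
rewrite /zprod -prodrXl -big_split /=; apply: eq_bigr => i _.
by rewrite -exprM -exprD muln2 addnC odd_double_half.
Qed.

Hypotheses (M_gt1 : (1 < M)%N) (sqM : squarefree M) (z0 : forall i, z i != 0).

Lemma zprod_norm_gt0 e : 0 < zsqrt_norm (zprod e).
Proof.
rewrite zsqrt_norm_zprod; apply: prodr_gt0 => i _.
by rewrite exprn_gt0 // zsqrt_norm_gt0 // ltnW.
Qed.

Lemma zprod_neq0 e : zprod e != 0.
Proof.
apply/eqP => h; have := zprod_norm_gt0 e.
by rewrite h /zsqrt_norm /= expr0n mulr0 addr0.
Qed.

(* Halving: if all exponents of a relation have matching parities, the relation is, up to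
   an integer factor, the square of a relation with halved exponents. *)
Lemma zprod_relation_descent L e f :
  (forall i, (e i < 2 ^ L)%N) -> (forall i, (f i < 2 ^ L)%N) -> (exists i, e i != f i) ->
  let t := zprod e * zsqrt_conj (zprod f) in (t.1 == 0) || (t.2 == 0) ->
  exists e' f', (exists i, odd (e' i) != odd (f' i)) /\
  let t' := zprod e' * zsqrt_conj (zprod f') in (t'.1 == 0) || (t'.2 == 0).
Proof.
elim: L e f => [|L IH] e f he hf [i0 ne] t ht.
  have := he i0; have := hf i0; rewrite !ltnS !leqn0 => /eqP ef /eqP ee.
  by rewrite ee ef in ne.
have [/existsP[i pe]|/existsPn same] := boolP [exists i, odd (e i) != odd (f i)].
  by exists e, f; split; first by exists i.
apply: (IH (fun i => (e i)./2) (fun i => (f i)./2)).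
- by move=> i; have := he i; rewrite expnS; lia.
- by move=> i; have := hf i; rewrite expnS; lia.
- by exists i0; have := same i0; move: ne; lia.
have ef : zprod (fun i => odd (f i)) = zprod (fun i => odd (e i)).
  by apply: eq_bigr => i _; have := same i; rewrite negbK => /eqP ->.
move: ht; rewrite {}/t (zprod_half e) (zprod_half f) ef zsqrt_conjM zsqrt_conjX.
move: (zprod_norm_gt0 (fun i => odd (e i))).
move: (zprod (fun i => odd (e i))) => r; move: (zprod _) (zsqrt_conj (zprod _)) => x y.
rewrite mulrACA zsqrt_mul_conj -exprMn.
case: (x * y) => a b N0; rewrite expr2 /= !mulr0 subr0 add0r.
rewrite !mulf_eq0 !(gt_eqF N0) !orbF subr_eq0.
(* In (a + b sqrt(-M))^2 the first coordinate vanishes only if a^2 = M b^2, hence b = 0; the second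
   only if a b = 0. *)
case/orP=> h.
  have /eqP -> : b == 0; last by rewrite eqxx orbT.
  apply/eqP; apply: (@squarefree_nonsquare M a) => //; move/eqP: h => h.
  by rewrite !expr2.
by move: h; rewrite mulrC -mulr2n mulrn_eq0 /= mulf_eq0 orbC.
Qed.

(** An element with a vanishing coordinate is T or T sqrt(-M); conjugation preserves norms, so the
    exponents add. *)
Lemma zprod_relation_norm e f :
  let t := zprod e * zsqrt_conj (zprod f) in (t.1 == 0) || (t.2 == 0) ->
  exists2 T : int, T != 0 &
    \prod_i zsqrt_norm (z i) ^+ (e i + f i) = T ^+ 2 \/
    \prod_i zsqrt_norm (z i) ^+ (e i + f i) = M%:Z * T ^+ 2.
Proof.
move=> t ht.
have eN : \prod_i zsqrt_norm (z i) ^+ (e i + f i) = zsqrt_norm t.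
  rewrite zsqrt_normM zsqrt_norm_conj !zsqrt_norm_zprod -big_split /=.
  by apply: eq_bigr => i _; rewrite exprD.
have t_gt0 : 0 < zsqrt_norm t.
  by rewrite zsqrt_normM zsqrt_norm_conj mulr_gt0 // zprod_norm_gt0.
rewrite eN; case/orP: ht => /eqP h.
  have e2 : zsqrt_norm t = M%:Z * t.2 ^+ 2 by rewrite /zsqrt_norm h expr0n add0r.
  exists t.2; last by right.
  by apply/eqP => h2; move: t_gt0; rewrite e2 h2 expr0n mulr0.
have e1 : zsqrt_norm t = t.1 ^+ 2 by rewrite /zsqrt_norm h expr0n mulr0 addr0.
exists t.1; last by left.
by apply/eqP => h2; move: t_gt0; rewrite e1 h2 expr0n.
Qed.

Lemma zprod_logn_bound e E p : (forall i, (e i <= E)%N) -> prime p ->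
  (logn p (absz (zsqrt_norm (zprod e))) <= E * \sum_i absz (zsqrt_norm (z i)))%N.
Proof.
move=> eE pp; rewrite zsqrt_norm_zprod big_distrr /=.
suff : (0 < absz (\prod_i zsqrt_norm (z i) ^+ e i)%R)%N /\
    (logn p (absz (\prod_i zsqrt_norm (z i) ^+ e i)%R) <=
      \sum_i E * absz (zsqrt_norm (z i)))%N by case.
elim/big_rec2: _ => [|i S x _ [x_gt0 xS]]; first by rewrite logn1.
have N_gt0 : (0 < absz (zsqrt_norm (z i)))%N.
  by rewrite absz_gt0 gt_eqF // zsqrt_norm_gt0 // ltnW.
rewrite abszM abszX muln_gt0 expn_gt0 N_gt0 x_gt0; split=> //.
rewrite lognM ?expn_gt0 ?N_gt0 // lognX leq_add // leq_mul //.
by rewrite ltnW // ltn_logl.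
Qed.

Lemma zprod_smooth e B :
  (forall i p, prime p -> (p%:Z %| zsqrt_norm (z i))%Z -> (p <= B)%N) ->
  forall p, prime p -> (p%:Z %| zsqrt_norm (zprod e))%Z -> (p <= B)%N.
Proof.
move=> smooth p pp; rewrite zsqrt_norm_zprod.
elim/big_rec: _ => [|i x _ IH].
  by rewrite dvdzE /= dvdn1; case: eqP pp => // ->.
rewrite Euclid_dvdz // => /orP[|]; last exact: IH.
case: (e i) => [|j]; first by rewrite dvdzE /= dvdn1; case: eqP pp => // ->.
by rewrite dvdzE abszX /= Euclid_dvdX // andbT; apply: smooth.
Qed.

End PowerProducts.

(** The rank bound. A primitive part is determined up to sign by its exponents at the r split primes
    and boundedly many bits, so two of the E^(r + 1) power products have proportional values.
    Halving then yields a relation with differing parities. *)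
Lemma norms_dependent M B (z : 'I_(#|split_primes M B|).+1 -> zsqrt M) :
  squarefree M -> (1 < M)%N -> (M %% 4 == 1)%N || (M %% 4 == 2)%N ->
  (forall i, z i != 0) ->
  (forall i p, prime p -> (p%:Z %| zsqrt_norm (z i))%Z -> (p <= B)%N) ->
  exists (c : 'I_(#|split_primes M B|).+1 -> nat) (T : int),
    [/\ exists i, odd (c i), T != 0 &
      \prod_i zsqrt_norm (z i) ^+ c i = T ^+ 2 \/
      \prod_i zsqrt_norm (z i) ^+ c i = M%:Z * T ^+ 2].
Proof.
set r := #|_| in z *; move=> sqM M_gt1 M4 z0 smooth; have M_gt0 := ltnW M_gt1.
have [s sP] := root_choice (- M%:Z).
pose C := (\sum_i absz (zsqrt_norm (z i)))%N.
(* Chosen so that E^(r + 1) exceeds the number of codes, (E C + 1)^r 4^(B + 1). *)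
pose E := (C.+1 ^ r * 2 ^ B.+1 * 2 ^ B.+1).+1.
pose ex (e : {ffun 'I_r.+1 -> 'I_E}) (i : 'I_r.+1) : nat := e i.
pose pr e := zsqrt_prim (zprod z (ex e)).
pose nn e := absz (zsqrt_norm (pr e)).
(* The exponents of the norm at the split primes, its divisors up to B, and one bit per prime for
   the root of -M. *)
pose code e : {ffun 'I_r -> 'I_(E * C).+1} * {set 'I_B.+1} * {set 'I_B.+1} :=
  ([ffun i => inord (logn (enum_val i : 'I_B.+1) (nn e))],
   [set p : 'I_B.+1 | (p %| nn e)%N],
   [set p : 'I_B.+1 | (p%:Z %| (pr e).1 + s p * (pr e).2)%Z]).
have [|e [f [nef ecode]]] := @pigeonhole _ _ code.
  rewrite !card_prod !card_ffun !card_ord.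
  have -> : #|{: {set 'I_B.+1}}| = (2 ^ B.+1)%N.
    by rewrite -cardsT -powersetT card_powerset cardsT card_ord.
  apply: (@leq_ltn_trans (E ^ r * (C.+1 ^ r * 2 ^ B.+1 * 2 ^ B.+1))).
    rewrite !mulnA -expnMn; apply: leq_mul => //; apply: leq_mul => //.
    have le : ((E * C).+1 <= E * C.+1)%N by rewrite mulnS -add1n leq_add2r.
    by case: (r) => // r'; rewrite leq_exp2r.
  by rewrite [X in (_ < X)%N]expnSr ltn_pmul2l // expn_gt0.
have primP e' : exists2 d : int, 0 < d &
    [/\ (zprod z (ex e')).1 = d * (pr e').1, (zprod z (ex e')).2 = d * (pr e').2,
        coprimez (pr e').1 (pr e').2, (0 < nn e')%N & zsqrt_norm (pr e') = (nn e')%:Z].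
  have [d d0 [e1 e2 cop]] := zsqrt_primP (zprod_neq0 M_gt1 z0 (ex e')).
  have p_gt0 : 0 < zsqrt_norm (pr e').
    apply: zsqrt_norm_gt0 => //; apply/eqP => p0.
    have := zprod_norm_gt0 M_gt1 z0 (ex e').
    rewrite -/(pr e') p0 /= !mulr0 in e1 e2.
    by rewrite /zsqrt_norm e1 e2 expr0n mulr0 addr0.
  by exists d; rewrite // /nn gtz0_abs // absz_gt0 gt_eqF.
have nn_dvd e' : (nn e' %| absz (zsqrt_norm (zprod z (ex e'))))%N.
  have [d _ [e1 e2 _ _ eN]] := primP e'.
  apply/dvdnP; exists (absz d ^ 2)%N; rewrite -abszX -abszM; congr absz.
  by rewrite /zsqrt_norm e1 e2; ring.
have logn_nn e' p : prime p -> (logn p (nn e') < (E * C).+1)%N.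
  move=> pp; rewrite ltnS.
  have eE i : (ex e' i <= E)%N by apply/ltnW/ltn_ord.
  apply: leq_trans (zprod_logn_bound M_gt1 z0 eE pp).
  by apply: dvdn_leq_log => //; rewrite absz_gt0 gt_eqF // zprod_norm_gt0.
have nn_smooth e' p : prime p -> (p %| nn e')%N -> (p < B.+1)%N.
  move=> pp pn; rewrite ltnS; apply: (zprod_smooth smooth pp (e := ex e')).
  by rewrite dvdzE; apply: dvdn_trans (nn_dvd e').
case: ecode => /ffunP code1 /setP code2 /setP code3.
have cross : (pr e).1 * (pr f).2 = (pr f).1 * (pr e).2.
  have [_ _ [_ _ cop n_gt0 en]] := primP e; have [_ _ [_ _ cop' n_gt0' en']] := primP f.
  have nn_ef p : prime p -> (p %| nn e)%N = (p %| nn f)%N.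
    move=> pp; have [pB|Bp] := ltnP p B.+1.
      by have := code2 (Ordinal pB); rewrite !inE.
    apply/idP/idP => h; first by have := nn_smooth e p pp h; rewrite ltnNge Bp.
    by have := nn_smooth f p pp h; rewrite ltnNge Bp.
  have enn : nn e = nn f.
    apply: eqn_from_log => // p.
    have [pp|/negbTE np] := boolP (prime p); last by rewrite (lognE p (nn e)) (lognE p (nn f)) np.
    have [pn|pn] := boolP (p %| nn e)%N; last first.
      by rewrite (lognE p (nn e)) (lognE p (nn f)) -nn_ef // (negbTE pn) !andbF.
    have pn' : (p %| nn f)%N by rewrite -nn_ef.
    (* A ramified prime divisor has exponent 1 in both norms; any other one is split, and its
       exponent belongs to the code. *)
    have [ram|] := boolP (~~ odd p || (p %| M)%N).
      have le1 : (logn p (nn e) <= 1)%N by apply: ramified_logn_le1 cop _ ram; rewrite // -en.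
      have le1' : (logn p (nn f) <= 1)%N by apply: ramified_logn_le1 cop' _ ram; rewrite // -en'.
      have ge1 : (0 < logn p (nn e))%N by rewrite logn_gt0 mem_primes pp n_gt0.
      have ge1' : (0 < logn p (nn f))%N by rewrite logn_gt0 mem_primes pp n_gt0'.
      by apply/eqP; rewrite eqn_leq (leq_trans le1 ge1') (leq_trans le1' ge1).
    rewrite negb_or negbK => /andP[op pM].
    have pB := nn_smooth e p pp pn.
    have pS : Ordinal pB \in split_primes M B.
      rewrite inE /= pp op pM; apply/qresP; first exact: prime_gt0.
      by have [] := qres_neg_of_dvd pp cop pM; rewrite // -[_ + _]/(zsqrt_norm (pr e)) en dvdzE.
    have := code1 (enum_rank_in pS (Ordinal pB)); rewrite !ffunE enum_rankK_in //=.
    by move/(congr1 val); rewrite /= !inordK // logn_nn.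
  apply: (primitive_rep_unique sqM M_gt1 M4 n_gt0 (s := s)) => //.
  - by move=> p pp /(sP p pp); rewrite opprK.
  - by rewrite enn -en'.
  - by move=> p pp pn; have := code3 (Ordinal (nn_smooth e p pp pn)); rewrite !inE.
have [||||e' [f' [ne' rel']]] := zprod_relation_descent M_gt1 sqM z0 (L := E) (e := ex e) (f := ex f).
- by move=> i; apply: ltn_trans (ltn_ord _) (ltn_expl _ _).
- by move=> i; apply: ltn_trans (ltn_ord _) (ltn_expl _ _).
- have /existsP[i ni] : [exists i, e i != f i].
    by apply: contraNT nef => /existsPn h; apply/eqP/ffunP => i; have := h i; rewrite negbK => /eqP.
  by exists i.
- have [d _ [e1 e2 _ _ _]] := primP e; have [d' _ [f1 f2 _ _ _]] := primP f.
  apply/orP; right; rewrite /= e1 e2 f1 f2; apply/eqP.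
  transitivity (d * d' * ((pr f).1 * (pr e).2 - (pr e).1 * (pr f).2)); first by ring.
  by rewrite cross subrr mulr0.
have [T T0 hT] := zprod_relation_norm M_gt1 z0 rel'.
exists (fun i => (e' i + f' i)%N), T; split=> //.
by case: ne' => i ni; exists i; rewrite oddD -negb_eqb.
Qed.

(** * The three-square theorem *)

Lemma F2_natr (x : 'F_2) : x = (x != 0)%:R.
Proof. by case: x => -[|[|]] // i; apply/val_inj. Qed.

Lemma F2_addb : {morph (fun b : bool => b%:R : 'F_2) : a b / a (+) b >-> a + b}.
Proof. by case=> -[]; apply/val_inj. Qed.

Lemma F2_sum (I : finType) (P : pred I) (F : I -> bool) :
  (\big[addb/false]_(i | P i) F i)%:R = \sum_(i | P i) (F i)%:R :> 'F_2.
Proof. exact: (big_morph _ F2_addb). Qed.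

Lemma F2_natr_eq0 (b : bool) : (b%:R == 0 :> 'F_2) = ~~ b.
Proof. by case: b. Qed.

Lemma enum_val_extend (T : finType) (J : {set T}) (c : 'I_#|J| -> bool) :
  exists e : T -> bool, forall i, e (enum_val i) = c i.
Proof.
exists (fun x => [exists i, (enum_val i == x) && c i]) => i.
apply/existsP/idP => [[j /andP[/eqP/enum_val_inj ->]] //|ci].
by exists i; rewrite eqxx.
Qed.

(** Either the matrix has rank |I| and every right-hand side is attained, or its left kernel has
    dimension at least |J| - |I| + 1 = r + 1. *)
Lemma F2_alternative (T : finType) (J I : {set T}) r (A : T -> T -> bool) (b : T -> bool) :
  #|J| = (r + #|I|)%N ->
  (exists e : T -> bool, forall i, i \in I ->
     \big[addb/false]_(j in J) (e j && A j i) = b i) \/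
  (exists K : 'I_r.+1 -> T -> bool,
     (forall k i, i \in I -> \big[addb/false]_(j in J) (K k j && A j i) = false) /\
     forall rho : 'I_r.+1 -> bool,
       (forall j, j \in J -> \big[addb/false]_k (rho k && K k j) = false) ->
       forall k, rho k = false).
Proof.
move=> cardJ.
pose Am : 'M['F_2]_(#|J|, #|I|) := \matrix_(i, j) (A (enum_val i) (enum_val j))%:R.
have sumE (e : T -> bool) (v : 'rV['F_2]_#|J|) i :
    (forall j, v 0 j = (e (enum_val j))%:R) -> forall iI : i \in I,
    (\big[addb/false]_(j in J) (e j && A j i))%:R = (v *m Am) 0 (enum_rank_in iI i).
  move=> ev iI; rewrite F2_sum big_enum_val mxE; apply: eq_bigr => j _.
  by rewrite ev mxE enum_rankK_in // -natrM mulnb.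
have [full|nfull] := boolP (row_full Am).
  left; pose bv : 'rV['F_2]_#|I| := \row_j (b (enum_val j))%:R.
  have /submxP[v ev] : (bv <= Am)%MS by exact: submx_full.
  have [e he] := enum_val_extend (fun i => v 0 i != 0).
  exists e => i iI; have := sumE e v i _ iI; rewrite -ev mxE enum_rankK_in // => h.
  have {}h := h (fun j => etrans (F2_natr _) (congr1 (fun c : bool => c%:R) (esym (he j)))).
  by apply: negb_inj; rewrite -!F2_natr_eq0 h.
right.
have rk : (r.+1 <= \rank (kermx Am))%N.
  have rkA : (\rank Am < #|I|)%N by rewrite ltn_neqAle rank_leq_col andbT.
  by rewrite mxrank_ker; move: (\rank Am) rkA => a ha; rewrite cardJ; lia.
(* The first r + 1 vectors of a basis of the left kernel. *)
pose Km : 'M['F_2]_(r.+1, #|J|) := pid_mx r.+1 *m row_base (kermx Am).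
have freeK : row_free Km.
  by rewrite /row_free mxrankMfree ?row_base_free // rank_pid_mx.
have KA : Km *m Am = 0.
  have h : row_base (kermx Am) *m Am = 0 by apply/sub_kermxP; rewrite eq_row_base.
  by rewrite -mulmxA h mulmx0.
have ext k := enum_val_extend (fun i => Km k i != 0).
have /fin_all_exists[K hK] : forall k, exists e : T -> bool,
    forall i, e (enum_val i) = (Km k i != 0) by exact: ext.
exists K; split=> [k i iI|rho hrho].
  have h j : (row k Km) 0 j = (K k (enum_val j))%:R by rewrite mxE hK -F2_natr.
  apply: negb_inj; rewrite -!F2_natr_eq0 (sumE _ _ _ h iI) -row_mul KA.
  by rewrite row0 mxE eqxx.
pose rv : 'rV['F_2]_r.+1 := \row_k (rho k)%:R.
have rv0 : rv *m Km = 0.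
  apply/rowP => j; rewrite !mxE.
  have := congr1 (fun c : bool => c%:R : 'F_2) (hrho _ (enum_valP j)).
  rewrite F2_sum => h; rewrite -[RHS]/(false%:R) -h; apply: eq_bigr => k _.
  by rewrite mxE -mulnb natrM hK -F2_natr.
have /rowP r0 : rv = 0 by apply/eqP; rewrite -(mulmx_free_eq0 _ freeK) rv0.
by move=> k; have := r0 k; rewrite !mxE => /eqP; rewrite F2_natr_eq0 => /negbTE.
Qed.

(** * Products of distinct primes *)

Lemma prod_primes_gt0 n (P : {set 'I_n}) : (forall j, j \in P -> prime j) -> (0 < \prod_(j in P) j)%N.
Proof. by move=> primeP; apply: prodn_cond_gt0 => j /primeP/prime_gt0. Qed.

Lemma logn_prod_primes n (P : {set 'I_n}) (p : 'I_n) :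
  (forall j, j \in P -> prime j) -> prime p -> logn p (\prod_(j in P) j) = (p \in P).
Proof.
move=> primeP pp.
have -> : logn p (\prod_(j in P) j) = (\sum_(j in P) (p == j))%N.
  suff : (0 < \prod_(j in P) j)%N /\ logn p (\prod_(j in P) j) = (\sum_(j in P) (p == j))%N by case.
  elim/big_rec2: _ => [|j S x /primeP jp [x_gt0 IH]]; first by rewrite logn1.
  have j_gt0 := prime_gt0 jp.
  by rewrite muln_gt0 j_gt0 x_gt0 lognM // IH logn_prime // -val_eqE.
have [pP|pP] := boolP (p \in P).
  rewrite (bigD1 p) //= eqxx big1 // => j /andP[_ /negbTE].
  by rewrite eq_sym => ->.
by rewrite big1 // => j jP; apply/eqP; rewrite eqb0; apply: contraNneq pP => ->.
Qed.

Lemma prime_dvd_prod_primes n (P : {set 'I_n}) p :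
  (forall j, j \in P -> prime j) -> prime p -> (p %| \prod_(j in P) j)%N ->
  exists2 j, j \in P & p = j.
Proof.
move=> primeP pp; elim/big_rec: _ => [|j x jP IH].
  by rewrite dvdn1; case: eqP pp => // ->.
rewrite Euclid_dvdM // => /orP[|/IH //].
by rewrite dvdn_prime2 ?primeP // => /eqP; exists j.
Qed.

Lemma squarefree_prod_primes n (P : {set 'I_n}) :
  (forall j, j \in P -> prime j) -> squarefree (\prod_(j in P) j).
Proof.
move=> primeP d dn; apply/eqP; apply: contraT => d1.
have b_gt0 := prod_primes_gt0 primeP.
have d_gt0 : (0 < d)%N by case: d dn d1 => //; rewrite dvd0n => /eqP b0; rewrite b0 in b_gt0.
have d_gt1 : (1 < d)%N by case: d d1 d_gt0 {dn} => // -[].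
have pp := pdiv_prime d_gt1.
have p2 : (pdiv d ^ 2 %| \prod_(j in P) j)%N.
  by apply: dvdn_trans dn; rewrite dvdn_exp2r // pdiv_dvd.
have [|j jP ej] := prime_dvd_prod_primes primeP pp.
  by apply: dvdn_trans p2; rewrite expnS dvdn_mulr.
move: p2; rewrite ej in pp *; rewrite pfactor_dvdn // logn_prod_primes //.
by case: (j \in P).
Qed.

Lemma qresb_prod (T : finType) (S : pred T) (x : T -> int) p : prime p ->
  (forall j, S j -> ~~ (p%:Z %| x j)%Z) ->
  ~~ qresb p (\prod_(j | S j) x j) = \big[addb/false]_(j | S j) ~~ qresb p (x j).
Proof.
move=> pp px.
suff : ~~ (p%:Z %| \prod_(j | S j) x j)%Z /\
  ~~ qresb p (\prod_(j | S j) x j) = \big[addb/false]_(j | S j) ~~ qresb p (x j) by case.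
elim/big_rec2: _ => [|j y1 y2 /px pj [py IH]].
  split; first by rewrite dvdzE /= dvdn1; case: eqP pp => // ->.
  apply: negbTE; rewrite negbK; apply/qresP; first exact: prime_gt0.
  by have := qres_sqr p 1; rewrite expr1n.
by rewrite Euclid_dvdz // negb_or pj py qresb_mul // IH.
Qed.

(** * Local characters of signed products of primes *)

Section Characters.
Variable M : nat.
Local Notation B := (2 * M)%N.
Hypotheses (sqM : squarefree M) (M_gt1 : (1 < M)%N).

(** For an odd prime l | M, the residue symbol of this unit at l is the Hilbert symbol (j, -M)_l; at
    j = l, the identity (l, -l)_l = 1 replaces -M by M / l. *)
Definition chi_gen (l j : 'I_B.+1) : int :=
  if j == ord0 then -1 else if j == l then (M %/ l)%:Z else j%:Z.

(* The index 0 stands for the generator -1 on the left and for the real place on the right. *)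
Definition chi (j l : 'I_B.+1) : bool :=
  if l == ord0 then j == ord0
  else if ~~ (l %| M)%N then j == l else ~~ qresb l (chi_gen l j).

(** When q is a prime divisor of the squarefree M, no product of these generators is M times a
    square. *)
Definition gens (q : 'I_B.+1) : {set 'I_B.+1} := ord0 |: [set j : 'I_B.+1 | prime j & j != q].

(** At a split prime every number is a local norm, so there is no condition to impose. *)
Definition places : {set 'I_B.+1} :=
  ord0 |: ([set l : 'I_B.+1 | prime l & odd l] :\: split_primes M B).

Definition gen_support q (e : 'I_B.+1 -> bool) : {set 'I_B.+1} :=
  [set j in gens q | (j != ord0) && e j].

Lemma gen_support_prime q e j : j \in gen_support q e -> prime j.
Proof. by rewrite !inE => /and3P[/orP[-> //|/andP[]]]. Qed.

(** Both sides count the primes up to B: -1 makes up for q on the left, the real place for 2 on the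
    right. *)
Lemma card_gens (q : 'I_B.+1) : prime q -> #|gens q| = (#|split_primes M B| + #|places|)%N.
Proof.
move=> pq; pose Pr := [set j : 'I_B.+1 | prime j].
have nz : (2 < B.+1)%N by rewrite ltnS; move: M_gt1; lia.
pose two := Ordinal nz.
have -> : #|gens q| = #|Pr|.
  rewrite cardsU1 !inE ?andbF /= (cardsD1 q Pr) inE pq; congr (_ + _)%N.
  by apply: eq_card => j; rewrite !inE andbC.
rewrite cardsU1 !inE ?andbF /= addnCA (cardsD1 two Pr) inE /=; congr (_ + _)%N.
rewrite -(cardsID (split_primes M B)); congr (_ + _)%N; apply: eq_card => j; rewrite !inE.
  rewrite -val_eqE /=; case: (boolP (prime j)) => pj; rewrite ?andbF //=.
  by case: eqP => // ->.
rewrite -val_eqE /=; case: (boolP (prime j)) => pj; rewrite ?andbF //=.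
by case: (even_prime pj) => [->|oj]; rewrite ?eqxx ?andbF // oj; case: eqP oj => // ->.
Qed.

(** The real place is left free, so that the sign, given by the exponent of -1, can be chosen either
    way. *)
Lemma legendre_data_of_chi q e :
  (forall l, l \in places -> l != ord0 ->
     \big[addb/false]_(j in gens q) (e j && chi j l) = false) ->
  legendre_data M (\prod_(j in gen_support q e) j) ((-1) ^+ e ord0).
Proof.
move=> he; set P := gen_support q e; have Ppr := @gen_support_prime q e.
have inP (j : 'I_B.+1) : (j \in P) = [&& prime j, j != q & e j].
  rewrite !inE; have [->|j0] := eqVneq j ord0; first by [].
  by rewrite /= andbA.
have dvdP (p : 'I_B.+1) : prime p -> (p %| \prod_(j in P) j)%N = (p \in P).
  move=> pp; apply/idP/idP => [/(prime_dvd_prod_primes Ppr pp)[j jP]|pP].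
    by move/val_inj ->.
  by rewrite (bigD1 p) //= dvdn_mulr.
(* At p | M the characters of the generators add up to that of one product, in which p itself enters
   as M / p. *)
have ram (p : 'I_B.+1) : prime p -> odd p -> (p %| M)%N ->
    qres p ((-1) ^+ e ord0 * \prod_(j in P) chi_gen p j).
  move=> pp op pM; have p0 : p != ord0 by apply: contraTneq pp => ->.
  have pl : p \in places by rewrite !inE (negbTE p0) /= pp op pM.
  have := he p pl p0; rewrite -big_mkcondr /=.
  under eq_bigr do rewrite /chi (negbTE p0) pM /=.
  rewrite -qresb_prod //; last first.
    move=> j /andP[jg _]; rewrite /chi_gen; case: eqVneq => [_|j0].
      by rewrite dvdzE /= dvdn1; case: eqP pp => // ->.
    case: eqVneq => [_|jp].
      rewrite dvdzE /=; apply/negP => pMp; have /negP := squarefree_prime_sqr pp sqM.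
      by apply; have := dvdn_mul pMp (dvdnn p); rewrite divnK // mulnn.
    move: jg; rewrite !inE (negbTE j0) /= => /andP[pj _].
    by rewrite dvdzE /= dvdn_prime2 // eq_sym.
  move/negbFE/qresP => /(_ (prime_gt0 pp)); congr qres.
  rewrite (bigID (pred1 ord0)) /=; congr (_ * _).
    case e0: (e ord0).
      rewrite (big_pred1 ord0) => [|j]; first by rewrite /chi_gen eqxx.
      by have [->|/negbTE] := eqVneq j ord0; [rewrite e0 !inE | rewrite andbF /= => ->].
    by rewrite big_pred0 // => j; have [->|] := eqVneq j ord0; rewrite ?andbF // e0 andbF.
  by apply: eq_bigl => j; rewrite [in RHS]inE -andbA; congr (_ && _); rewrite andbC.
have genP (p j : 'I_B.+1) : j \in P -> j != p -> chi_gen p j = j%:Z.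
  move=> jP jp; rewrite /chi_gen (negbTE jp); case: eqVneq => // j0.
  by have := Ppr j jP; rewrite j0.
split.
- exact: squarefree_prod_primes.
- move=> p pp op /(prime_dvd_prod_primes Ppr pp)[j jP ep] pM.
  rewrite {}ep in pp op pM *; have j0 : j != ord0 by apply: contraTneq pp => ->.
  have [|nsp] := boolP (j \in split_primes M B).
    by rewrite inE => /and4P[_ _ _ /qresP]; apply; apply: prime_gt0.
  have jl : j \in places by rewrite finset.in_setU1 finset.in_setD nsp inE pp op orbT.
  (* The prime j is inert, and only the generator j has a nontrivial character there, so its
     exponent would be 0. *)
  have := he j jl j0; move: (jP); rewrite inE => /and3P[jg _ ej].
  rewrite (bigD1 j) //= ej /chi (negbTE j0) pM eqxx big1 // => i /andP[_ /negbTE ->].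
  by rewrite andbF.
- move=> p pp op pM pb.
  have pB : (p < B.+1)%N by rewrite ltnS (leq_trans (dvdn_leq _ pM)) // ?(ltnW M_gt1) // leq_pmull.
  have pP : Ordinal pB \notin P by rewrite -dvdP.
  have := ram (Ordinal pB) pp op pM; congr (qres _ (_ * _)).
  rewrite (big_morph Posz PoszM (erefl _)); apply: eq_bigr => j jP; apply: genP => //.
  by apply: contraNneq pP => <-.
- move=> p pp op pM pb.
  have pB : (p < B.+1)%N by rewrite ltnS (leq_trans (dvdn_leq _ pM)) // ?(ltnW M_gt1) // leq_pmull.
  have pP : Ordinal pB \in P by rewrite -dvdP.
  have := ram (Ordinal pB) pp op pM; rewrite -mulrA; congr (qres _ (_ * _)).
  rewrite (bigD1 (Ordinal pB)) //= [in RHS](bigD1 (Ordinal pB)) //= mulKn ?prime_gt0 // mulrC.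
  congr (_ * _).
    rewrite (big_morph Posz PoszM (erefl _)); apply: eq_bigr => j /andP[jP jp]; exact: genP.
  rewrite /chi_gen eqxx; case: eqVneq => // p0.
  by have := Ppr _ pP; rewrite p0.
Qed.

End Characters.

(** * Sums of three squares for M = 1 or 2 modulo 4 *)

Lemma odd_logn_prod k (b W c : 'I_k -> nat) p : prime p ->
  (forall i, (0 < b i)%N) -> (forall i, (0 < W i)%N) ->
  odd (logn p (\prod_i (b i * W i ^ 2) ^ c i)) =
  \big[addb/false]_i (odd (c i) && odd (logn p (b i))).
Proof.
move=> pp b_gt0 W_gt0.
suff : (0 < \prod_i (b i * W i ^ 2) ^ c i)%N /\
  odd (logn p (\prod_i (b i * W i ^ 2) ^ c i)) =
  \big[addb/false]_i (odd (c i) && odd (logn p (b i))) by case.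
elim/big_rec2: _ => [|i y x _ [x_gt0 IH]]; first by rewrite logn1.
have bW : (0 < b i * W i ^ 2)%N by rewrite muln_gt0 b_gt0 expn_gt0 W_gt0.
rewrite muln_gt0 expn_gt0 bW x_gt0 lognM ?expn_gt0 ?bW // oddD IH; split=> //.
by rewrite lognX oddM lognM ?expn_gt0 ?W_gt0 // lognX oddD oddM /= addbF.
Qed.

Lemma squarefree_three_squares M : squarefree M -> (1 < M)%N ->
  (M %% 4 == 1)%N || (M %% 4 == 2)%N ->
  exists x y z : int, M%:Z = x ^+ 2 + y ^+ 2 + z ^+ 2.
Proof.
move=> sqM M_gt1 M4; have M_gt0 := ltnW M_gt1.
have pq := pdiv_prime M_gt1.
have qB : (pdiv M < (2 * M).+1)%N.
  by rewrite ltnS (leq_trans (dvdn_leq _ (pdiv_dvd M))) // leq_pmull.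
pose q := Ordinal qB.
have chi0 (e : 'I_(2 * M).+1 -> bool) :
    \big[addb/false]_(j in gens q) (e j && chi j ord0) = e ord0.
  rewrite (bigD1 ord0) ?inE //= /chi eqxx andbT big1 ?addbF // => j /andP[_ /negbTE ->].
  by rewrite andbF.
(* The wanted product is trivial at every finite place and negative. If there is none, r + 1
   independent products are trivial at all places, the real one included, and all of them are norms
   up to squares. *)
have [[e he]|[K [hK freeK]]] :=
  F2_alternative (@chi M) (fun l => l == ord0) (@card_gens M M_gt1 q pq).
  apply: (legendre_three_squares (b := (\prod_(j in gen_support q e) j)%N)) => //.
  have e0 : e ord0 = true by rewrite -chi0 he ?inE ?eqxx.
  have := @legendre_data_of_chi M sqM M_gt1 q e; rewrite e0 expr1; apply=> l lp /negbTE l0.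
  by rewrite he.
pose b k := (\prod_(j in gen_support q (K k)) j)%N.
have K0 k : K k ord0 = false by rewrite -chi0 hK // finset.setU11.
have b_gt0 k : (0 < b k)%N by apply/prod_primes_gt0/gen_support_prime.
have norm_ex k : exists xyW : zsqrt M * nat, [/\ (0 < xyW.2)%N, (xyW.2 <= 2 * M)%N
    & zsqrt_norm xyW.1 = (b k * xyW.2 ^ 2)%N%:Z].
  have [|x [y [W [W0 WB exy]]]] := legendre_norm sqM M_gt1 (b := b k).
    have := @legendre_data_of_chi M sqM M_gt1 q (K k); rewrite K0 expr0; apply=> l lp _.
    exact: hK.
  by exists ((x, y), W); split=> //; rewrite /zsqrt_norm /= exy.
have [xyW hz] := fin_all_exists norm_ex.
pose z k := (xyW k).1; pose W k := (xyW k).2.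
have [||c [t [[k0 ck0] t0 ht]]] := norms_dependent (z := z) sqM M_gt1 M4.
- move=> k; apply/eqP => zk0; have [W0 _] := hz k; rewrite -/(z k) zk0.
  rewrite /zsqrt_norm /= expr0n mulr0 => /eqP; rewrite eqz_nat eq_sym.
  by rewrite muln_eq0 expn_eq0 /= !eqn0Ngt b_gt0 W0.
- move=> k p pp; have [W0 WB ->] := hz k; rewrite dvdzE /= Euclid_dvdM // Euclid_dvdX // andbT.
  case/orP=> [|pW]; last by rewrite (leq_trans _ WB) // dvdn_leq.
  case/(prime_dvd_prod_primes (@gen_support_prime M q (K k)) pp)=> j _ ->.
  by rewrite -ltnS.
have prodE : \prod_i zsqrt_norm (z i) ^+ c i = (\prod_i (b i * W i ^ 2) ^ c i)%N%:Z.
  rewrite (big_morph Posz PoszM (erefl _)); apply: eq_bigr => i _.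
  by have [_ _ ->] := hz i; rewrite -!natz natrX.
have W_gt0 i : (0 < W i)%N by case: (hz i).
have lognb (j : 'I_(2 * M).+1) k : prime j -> odd (logn j (b k)) = (j != q) && K k j.
  move=> pj; rewrite logn_prod_primes //; last exact: gen_support_prime.
  rewrite oddb !inE; have [j0|j0] := eqVneq j ord0; first by rewrite j0 in pj.
  by rewrite pj.
have tpos : (0 < absz t)%N by rewrite absz_gt0.
(* The value M T^2 is excluded by the exponent of q, which is odd there but even in the product, as
   q is not a generator. *)
have eT : (\prod_i (b i * W i ^ 2) ^ c i = absz t ^ 2)%N.
  move: ht; rewrite prodE => -[ht|ht]; first by rewrite -abszX -ht.
  have : (\prod_i (b i * W i ^ 2) ^ c i = M * absz t ^ 2)%N.
    by rewrite -abszX -[M in RHS]absz_nat -abszM -ht.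
  move/(congr1 (fun n => odd (logn q n))); rewrite odd_logn_prod //= lognM ?expn_gt0 ?tpos //.
  rewrite lognX oddD oddM addbF (logn_squarefree pq sqM (pdiv_dvd M)) big1 // => i _.
  by rewrite (lognb q i pq) eqxx andbF.
suff h : odd (c k0) = false by rewrite h in ck0.
(* Even exponents at all primes of a square amount to a linear relation between the vectors [K k],
   with coefficients [c k] modulo 2. *)
apply: (freeK (fun k => odd (c k))) => j; rewrite !inE => /orP[/eqP ->|/andP[pj jq]].
  by rewrite big1 // => k _; rewrite K0 andbF.
have := odd_logn_prod c pj b_gt0 W_gt0; rewrite eT lognX oddM /= => h.
by apply: etrans (esym h); apply: eq_bigr => k _; rewrite lognb // jq.
Qed.

(** Squares are 0 or 1 modulo 4, so the squarefree part of M is again 1 or 2 modulo 4. *)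
Lemma three_squares M : (0 < M)%N -> (M %% 4 == 1)%N || (M %% 4 == 2)%N ->
  exists x y z : int, M%:Z = x ^+ 2 + y ^+ 2 + z ^+ 2.
Proof.
move=> M_gt0 M4; have [M0 [sq0 [k eM]]] := squarefree_part_exists M_gt0.
have ek : M%:Z = M0%:Z * k%:Z ^+ 2 by rewrite eM PoszM expnS expn1 PoszM.
have [M0_le1|M0_gt1] := leqP M0 1.
  have M01 : M0 = 1%N by have := squarefree_gt0 sq0; lia.
  by exists k%:Z, 0, 0; rewrite ek M01; ring.
have [|x [y [z e0]]] := squarefree_three_squares sq0 M0_gt1.
  have k2 : (k ^ 2 %% 4 == 1)%N || (k ^ 2 %% 4 == 0)%N.
    rewrite -modnXm; have : (k %% 4 < 4)%N by rewrite ltn_mod.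
    by case: (k %% 4)%N => [|[|[|[|]]]].
  move: M4; rewrite eM -modnMm; have : (M0 %% 4 < 4)%N by rewrite ltn_mod.
  by case/orP: k2 => /eqP ->; case: (M0 %% 4)%N => [|[|[|[|]]]].
by exists (k%:Z * x), (k%:Z * y), (k%:Z * z); rewrite ek e0; ring.
Qed.

(** * Sums of vectors on a rational sphere *)

Definition vec3 (x y z : rat) : 'rV[rat]_3 := \row_(i < 3) nth 0 [:: x; y; z] i.

Lemma vec3E (v : 'rV[rat]_3) :
  v = vec3 (v ord0 ord0) (v ord0 (lift ord0 ord0)) (v ord0 (lift ord0 (lift ord0 ord0))).
Proof.
apply/rowP => -[[|[|[|//]]] hi]; rewrite mxE /=; congr (v _ _); exact/val_inj.
Qed.

Definition sqn (v : 'rV[rat]_3) : rat := \sum_i v ord0 i ^+ 2.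

Lemma sqn_vec3 x y z : sqn (vec3 x y z) = x ^+ 2 + y ^+ 2 + z ^+ 2.
Proof. by rewrite /sqn !big_ord_recl big_ord0 !mxE /= addr0 addrA. Qed.

Lemma vec3D x y z x' y' z' : vec3 x y z + vec3 x' y' z' = vec3 (x + x') (y + y') (z + z').
Proof. by apply/rowP => -[[|[|[|//]]] hi]; rewrite !mxE. Qed.

Lemma vec3Z a x y z : a *: vec3 x y z = vec3 (a * x) (a * y) (a * z).
Proof. by apply/rowP => -[[|[|[|//]]] hi]; rewrite !mxE. Qed.

Lemma sqnZ a v : sqn (a *: v) = a ^+ 2 * sqn v.
Proof. by rewrite [v]vec3E vec3Z !sqn_vec3; ring. Qed.

Lemma sqn_eq0 v : (sqn v == 0) = (v == 0).
Proof.
apply/idP/eqP => [|->]; last by rewrite /sqn big1 // => i _; rewrite mxE expr0n.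
rewrite psumr_eq0 => [/allP h|i _]; last exact: sqr_ge0.
by apply/rowP => i; have := h i (mem_index_enum _); rewrite sqrf_eq0 mxE => /eqP.
Qed.

Lemma rat_sphereE (R : realType) (h : rat) v : 0 <= h -> rat_sphere R h v <-> sqn v = h.
Proof.
move=> h0; rewrite /rat_sphere /enorm.
have -> : \sum_(i < 3) ratr (v ord0 i) ^+ 2 = ratr (sqn v) :> R.
  by rewrite rmorph_sum; apply: eq_bigr => i _; rewrite rmorphXn.
have v0 : 0 <= sqn v by apply: sumr_ge0 => i _; apply: sqr_ge0.
split=> [/eqP|->//].
by rewrite eqr_sqrt ?ler0q // => /eqP/(fmorph_inj (ratr : {rmorphism rat -> R})).
Qed.

Section SphereSums.
Variable h : rat.

Definition sphere_sum (v : 'rV[rat]_3) : Prop :=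
  exists s : seq 'rV[rat]_3, (forall x, x \in s -> sqn x = h) /\ v = \sum_(x <- s) x.

Lemma sphere_sum_gen v : sqn v = h -> sphere_sum v.
Proof.
move=> hv; exists [:: v]; rewrite big_seq1; split=> // x.
by rewrite inE => /eqP ->.
Qed.

Lemma sphere_sumD u v : sphere_sum u -> sphere_sum v -> sphere_sum (u + v).
Proof.
move=> [s [hs ->]] [r [hr ->]]; exists (s ++ r); rewrite big_cat; split=> // x.
by rewrite mem_cat => /orP[/hs|/hr].
Qed.

Lemma sphere_sum_map (f : {linear 'rV[rat]_3 -> 'rV[rat]_3}) v :
  (forall x, sqn (f x) = sqn x) -> sphere_sum v -> sphere_sum (f v).
Proof.
move=> hf [s [hs ->]]; exists (map f s); split; last by rewrite big_map raddf_sum.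
by move=> y /mapP[x xs ->]; rewrite hf hs.
Qed.

(* The reflection exchanging two vectors of equal length is a rational isometry. *)
Lemma sphere_sum_isom u v : sqn u = sqn v -> sphere_sum u -> sphere_sum v.
Proof.
move=> uv; have [->//|nuv] := eqVneq u v.
pose w := u - v; have w0 : sqn w != 0 by rewrite sqn_eq0 subr_eq0.
pose A : 'M[rat]_3 := 1%:M - (2 / sqn w) *: (w^T *m w).
have fE x : x *m A = x - (2 / sqn w * \sum_i x ord0 i * w ord0 i) *: w.
  rewrite mulmxBr mulmx1 -scalemxAr mulmxA; congr (_ - _).
  rewrite -scalerA; congr (_ *: _).
  rewrite [x *m w^T]mx11_scalar mul_scalar_mx; congr (_ *: _).
  by rewrite mxE; apply: eq_bigr => i _; rewrite mxE.
(* Equal lengths give 2 <u, u - v> = |u - v|^2, so the reflection along w = u - v sends u to u - w =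
   v. *)
have -> : v = mulmxr A u.
  rewrite /= fE; suff -> : 2 / sqn w * \sum_i u ord0 i * w ord0 i = 1.
    by rewrite scale1r subKr.
  apply: (mulfI w0); rewrite mulr1 mulrA mulrCA divff // mulr1.
  move: uv; rewrite /w /sqn !big_ord_recl !big_ord0 !mxE.
  by move: (u _ _) (u _ _) (u _ _) (v _ _) (v _ _) (v _ _) => *; lra.
apply: sphere_sum_map => x; rewrite /= fE.
have -> : sqn (x - (2 / sqn w * \sum_i x ord0 i * w ord0 i) *: w) =
    sqn x - 2 * (2 / sqn w * \sum_i x ord0 i * w ord0 i) * (\sum_i x ord0 i * w ord0 i)
    + (2 / sqn w * \sum_i x ord0 i * w ord0 i) ^+ 2 * sqn w.
  move: (2 / sqn w * _) => c; rewrite /sqn !big_ord_recl !big_ord0 !mxE; ring.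
by move: (\sum_i _) (sqn x) => c d; field.
Qed.

End SphereSums.

(** * Division by odd numbers *)

Lemma sum_two_squares_neg1 p : prime p -> exists s t : int, (p%:Z %| 1 + s ^+ 2 + t ^+ 2)%Z.
Proof.
move=> pp; have p_gt0 := prime_gt0 pp.
have [/qresP-/(_ p_gt0)[s hs]|n1] := boolP (qresb p (-1)).
  by exists s, 0; rewrite expr0n addr0 addrC -[1]opprK.
(* Write the least nonresidue as n + 1: then n and - (n + 1) are residues. *)
have exn : exists n, ~~ qresb p n%:Z.
  exists p.-1; apply: contra n1 => /qresP-/(_ p_gt0) q1; apply/qresP => //.
  by apply: qres_cong q1; rewrite opprK -PoszD addn1 prednK.
case: (ex_minnP exn) => -[|n] nn min.
  by case/negP: nn; apply/qresP => //; have := qres_sqr p 0; rewrite expr0n.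
have [t ht] : qres p n%:Z.
  by apply/qresP => //; apply: contraT => /min; rewrite ltnn.
have [||||s hs] := @qres_nonres_mul p (-1) n.+1%:Z pp.
- by rewrite dvdzE /= dvdn1; case: eqP pp => // ->.
- apply: contra nn => pn; apply/qresP => //; apply: qres_cong (qres_sqr p 0).
  by rewrite expr0n sub0r rpredN.
- by move/qresP => /(_ p_gt0); apply/negP.
- by move/qresP => /(_ p_gt0); apply/negP.
exists s, t.
rewrite (_ : _ + _ = (s ^+ 2 - -1 * n.+1%:Z) + (t ^+ 2 - n%:Z)); first exact: rpredD.
by rewrite intS; ring.
Qed.

Section SphereSumsCoordinates.
Variable h : rat.
Local Notation G := (sphere_sum h).

Lemma sphere_sum_vec3D x y z x' y' z' : G (vec3 x y z) -> G (vec3 x' y' z') ->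
  G (vec3 (x + x') (y + y') (z + z')).
Proof. by rewrite -vec3D; apply: sphere_sumD. Qed.

Lemma sphere_sum0 : G (vec3 0 0 0).
Proof.
exists [::]; rewrite big_nil; split=> //.
by apply/rowP => -[[|[|[|//]]] hi]; rewrite !mxE.
Qed.

Lemma sphere_sum_opp x y z : G (vec3 x y z) -> G (vec3 (- x) (- y) (- z)).
Proof. by apply: sphere_sum_isom; rewrite !sqn_vec3; ring. Qed.

Lemma sphere_sum_int (a : int) x y z : G (vec3 x y z) ->
  G (vec3 (a%:~R * x) (a%:~R * y) (a%:~R * z)).
Proof.
move=> g; have nat_case (n : nat) : G (vec3 (n%:R * x) (n%:R * y) (n%:R * z)).
  elim: n => [|n IH]; first by rewrite !mul0r; apply: sphere_sum0.
  by have := sphere_sum_vec3D g IH; congr (G (vec3 _ _ _)); rewrite -natr1; ring.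
case: a => n; first exact: nat_case.
by have := sphere_sum_opp (nat_case n.+1); rewrite NegzE mulrNz !mulNr.
Qed.

(** The half-turn about the first axis cancels the other coordinates. *)
Lemma sphere_sum_axis x y z : G (vec3 x y z) -> G (vec3 (2 * x) 0 0).
Proof.
move=> g; have g' : G (vec3 x (- y) (- z)).
  by apply: sphere_sum_isom g; rewrite !sqn_vec3; ring.
by have := sphere_sum_vec3D g g'; rewrite !subrr (_ : x + x = 2 * x) //; ring.
Qed.

(** Move (x, 0, 0) to a direction of denominator N = m p, return to the axis by a half-turn and
    multiply by m: this gives 4 s x / p, and a Bezout combination with x gives x / p. *)
Lemma sphere_sum_axis_prime p x : prime p -> odd p -> G (vec3 x 0 0) -> G (vec3 (x / p%:R) 0 0).
Proof.
move=> pp op g; have [s0 [t0 pst]] := sum_two_squares_neg1 pp.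
(* If p divided both s and t it would divide 1; after a swap, s is a unit modulo p. *)
have [s [t [ps]]] : exists s t : int, ~~ (p%:Z %| s)%Z /\ (p%:Z %| 1 + s ^+ 2 + t ^+ 2)%Z.
  have [ps|ps] := boolP (p%:Z %| s0)%Z; last by exists s0, t0.
  exists t0, s0; split; last by rewrite addrAC.
  apply/negP => pt; move: pst; rewrite rpredDr ?Euclid_dvdz_sqr // rpredDr ?Euclid_dvdz_sqr //.
  by rewrite dvdzE /= dvdn1; case: eqP pp => // ->.
case/dvdzP=> m eN.
have N0 : (1 + s%:~R ^+ 2 + t%:~R ^+ 2 : rat) != 0.
  by rewrite gt_eqF // -addrA ltr_pwDl // addr_ge0 // sqr_ge0.
set N := 1 + _ + _ in N0.
have eNq : N = m%:~R * p%:R by rewrite [p%:R]pmulrn -rmorphM -eN !rmorphD !rmorphXn.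
have p0 : p%:R != 0 :> rat by rewrite pnatr_eq0 -lt0n prime_gt0.
have m0 : m%:~R != 0 :> rat by apply: contraNneq N0; rewrite eNq => ->; rewrite mul0r.
(* The unit vector (2 s, 2 t, N - 2) / N is the inverse stereographic image of (s, t). *)
have g1 : G (vec3 (x * (2 * s%:~R / N)) (x * (2 * t%:~R / N)) (x * ((N - 2) / N))).
  apply: sphere_sum_isom g; rewrite !sqn_vec3 /N; field; exact: N0.
have := sphere_sum_int m (sphere_sum_axis g1); rewrite !mulr0.
have -> : m%:~R * (2 * (x * (2 * s%:~R / N))) = (4 * s)%:~R * (x / p%:R).
  by rewrite rmorphM /= eNq; field; rewrite p0 m0.
move=> g2.
have /eqP cop : gcdz (4 * s) p%:Z == 1.
  rewrite -[_ == _]/(coprimez _ _) coprimez_sym coprimezE absz_nat prime_coprime //.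
  rewrite -[p]absz_nat -dvdzE (_ : 4 * s = 2%:Z * (2%:Z * s)); last by ring.
  rewrite !Euclid_dvdz // !negb_or ps andbT andbb dvdzE /= dvdn_prime2 //.
  by apply: contraTneq op => ->.
have [a [b eab]] := Bezoutz (4 * s) p%:Z; rewrite cop in eab.
have := sphere_sum_vec3D (sphere_sum_int a g2) (sphere_sum_int b g); rewrite !mulr0 !addr0.
congr (G (vec3 _ _ _)).
transitivity ((a * (4 * s) + b * p%:Z)%:~R * (x / p%:R)); last by rewrite eab mul1r.
by rewrite rmorphD !rmorphM /= -pmulrn; field.
Qed.

Lemma sphere_sum_axis_div d x : odd d -> G (vec3 x 0 0) -> G (vec3 (x / d%:R) 0 0).
Proof.
elim/ltn_ind: d x => d IH x od g; have [d_le1|d_gt1] := leqP d 1.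
  by have -> : d = 1%N by [case: d od d_le1 {IH} => [|[|]]]; rewrite divr1.
have pp := pdiv_prime d_gt1; have ed := divnK (pdiv_dvd d).
have /andP[od' op] : odd (d %/ pdiv d) && odd (pdiv d) by rewrite -oddM ed.
have := IH (d %/ pdiv d)%N _ _ od' (sphere_sum_axis_prime pp op g).
rewrite ltn_Pdiv ?prime_gt1 ?(ltnW d_gt1) // => /(_ isT).
by rewrite -mulrA -invfM -natrM mulnC ed.
Qed.

Lemma sphere_sum_double (d : nat) (x y z : int) : odd d -> G (vec3 2 0 0) ->
  G (vec3 (2 * x%:~R / d%:R) (2 * y%:~R / d%:R) (2 * z%:~R / d%:R)).
Proof.
move=> od /(sphere_sum_axis_div od) g.
have g2 : G (vec3 0 (2 / d%:R) 0) by apply: sphere_sum_isom g; rewrite !sqn_vec3; ring.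
have g3 : G (vec3 0 0 (2 / d%:R)) by apply: sphere_sum_isom g; rewrite !sqn_vec3; ring.
have := sphere_sum_vec3D (sphere_sum_vec3D (sphere_sum_int x g) (sphere_sum_int y g2))
  (sphere_sum_int z g3).
rewrite !mulr0 !addr0 !add0r.
by congr (G (vec3 _ _ _)); ring.
Qed.

End SphereSumsCoordinates.

(** * Reduction modulo 2 *)

Lemma int_parity (x : int) : exists (a : int) (e : bool), x = 2 * a + e%:Z.
Proof.
exists (x %/ 2)%Z, (x %% 2 != 0)%Z; have := divz_eq x 2.
have := modz_ge0 x (d := 2) isT; have := ltz_pmod x (d := 2) isT; lia.
Qed.

Lemma sqr_parity (u : int) (e : bool) : exists q, (2 * u + e%:Z) ^+ 2 = 4 * q + e%:Z.
Proof.
case: e => /=; first by exists (u ^+ 2 + u); rewrite -[Posz 1]/(1 : int); ring.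
by exists (u ^+ 2); rewrite -[Posz 0]/(0 : int); ring.
Qed.

(** Modulo 4 the sum counts the odd coordinates, so one or two are odd; a permutation puts an odd
    one first and an even one last. *)
Lemma three_squares_parity M (x y z : int) : (M %% 4 == 1)%N || (M %% 4 == 2)%N ->
  M%:Z = x ^+ 2 + y ^+ 2 + z ^+ 2 ->
  exists (a b c : int) (e : bool),
    M%:Z = (2 * a + 1) ^+ 2 + (2 * b + e%:Z) ^+ 2 + (2 * c) ^+ 2.
Proof.
move=> M4 eM; have [a [e1 ex]] := int_parity x; have [b [e2 ey]] := int_parity y.
have [c [e3 ez]] := int_parity z.
have par : ((e1 + e2 + e3 == 1) || (e1 + e2 + e3 == 2))%N.
  have [q1 h1] := sqr_parity a e1; have [q2 h2] := sqr_parity b e2.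
  have [q3 h3] := sqr_parity c e3; move: eM; rewrite ex ey ez h1 h2 h3.
  by clear -M4; case: e1 e2 e3 => -[] []; lia.
move: eM; rewrite ex ey ez {ex ey ez x y z}.
have [T1 F0] : true%:Z = 1 /\ false%:Z = 0 by [].
case: e1 e2 e3 par => -[] [] // _; rewrite ?T1 ?F0 => ->.
- by exists a, b, c, true; rewrite T1; ring.
- by exists a, c, b, true; rewrite T1; ring.
- by exists a, b, c, false; rewrite F0; ring.
- by exists b, c, a, true; rewrite T1; ring.
- by exists b, a, c, false; rewrite F0; ring.
- by exists c, a, b, false; rewrite F0; ring.
Qed.

(** The group contains (2, 0, 0), hence every 2 (x, y, z) / d with d odd. Modulo these, the
    generator given by three squares is (1, e, 0), and both values of e lead to (1, 1, 0). *)
Lemma sphere_sum_even M (d : nat) (X Y Z : int) : (0 < M)%N ->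
  (M %% 4 == 1)%N || (M %% 4 == 2)%N -> odd d -> (2 %| X + Y + Z)%Z ->
  sphere_sum M%:R (vec3 (X%:~R / d%:R) (Y%:~R / d%:R) (Z%:~R / d%:R)).
Proof.
move=> M_gt0 M4 od /dvdzP[m em].
have [x [y [z eM]]] := three_squares M_gt0 M4.
have {x y z eM} [a [b [c [e eM]]]] := three_squares_parity M4 eM.
have g0 : sphere_sum M%:R (vec3 (2 * a%:~R + 1) (2 * b%:~R + e%:R) (2 * c%:~R)).
  apply: sphere_sum_gen; rewrite sqn_vec3 [M%:R]pmulrn eM.
  by rewrite !(rmorphD, rmorphXn, rmorphM) /= -[e%:~R]pmulrn.
(* Twice the odd number 2 a + 1 lies on the axis; dividing by its absolute value leaves 2 or -2. *)
have g2 : sphere_sum M%:R (vec3 2 0 0).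
  have oa : odd (absz (2 * a + 1)) by lia.
  have a0 : 2 * a%:~R + 1 != 0 :> rat.
    by rewrite (_ : _ + 1 = (2 * a + 1)%:~R) ?intr_eq0 ?rmorphD ?rmorphM //; lia.
  apply: sphere_sum_isom (sphere_sum_axis_div oa (sphere_sum_axis g0)).
  rewrite !sqn_vec3 [(absz _)%:R]pmulrn abszE.
  have -> : (`|2 * a + 1| : int)%:~R = `|2 * a%:~R + 1| :> rat.
    by rewrite intr_norm rmorphD rmorphM.
  rewrite expr_div_n real_normK ?num_real //; field; exact: a0.
have dbl (n : nat) x y z : odd n -> sphere_sum M%:R
    (vec3 (2 * x%:~R / n%:R) (2 * y%:~R / n%:R) (2 * z%:~R / n%:R)).
  by move=> on; apply: sphere_sum_double.
have g1 : sphere_sum M%:R (vec3 1 e%:R 0).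
  have := sphere_sum_vec3D g0 (dbl 1%N (- a) (- b) (- c) isT).
  by congr (sphere_sum _ (vec3 _ _ _)); rewrite rmorphN /=; field.
have g11 : sphere_sum M%:R (vec3 1 1 0).
  case: (e) g1 => //=; rewrite mulr0n => g1.
  have g1' : sphere_sum M%:R (vec3 0 1 0) by apply: sphere_sum_isom g1; rewrite !sqn_vec3; ring.
  by have := sphere_sum_vec3D g1 g1'; rewrite !addr0 !add0r.
have g12 : sphere_sum M%:R (vec3 0 1 1) by apply: sphere_sum_isom g11; rewrite !sqn_vec3; ring.
have [k ek] : exists k, d = k.*2.+1 by exists d./2; rewrite -{1}(odd_double_half d) od.
have d0 : d%:R != 0 :> rat by rewrite pnatr_eq0; case: (d) od.
(* (X,Y,Z)/d = X(1,1,0) + Z(0,1,1) + 2(0,m-X-Z,0) - 2k(X,Y,Z)/d since d = 2k + 1. *)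
have := sphere_sum_vec3D (sphere_sum_vec3D (sphere_sum_int X g11) (sphere_sum_int Z g12))
  (sphere_sum_vec3D (dbl 1%N 0 (m - X - Z) 0 isT) (dbl d (- (k%:Z * X)) (- (k%:Z * Y)) (- (k%:Z * Z)) od)).
have eY : Y%:~R = 2 * m%:~R - X%:~R - Z%:~R :> rat.
  rewrite (_ : Y = m * 2 - X - Z); last by rewrite -em; ring.
  by rewrite !rmorphB rmorphM /=; ring.
have edq : d%:R = 2 * k%:R + 1 :> rat by rewrite ek -natr1 -muln2 natrM; ring.
congr (sphere_sum _ (vec3 _ _ _)); rewrite !(rmorphN, rmorphM, rmorphB) /= -?[k%:~R]pmulrn ?rmorph0 ?eY.
- by move: d0; rewrite edq => d0; field.
- by move: d0; rewrite edq => d0; field.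
- by move: d0; rewrite edq => d0; field.
Qed.

(** Descent on a common denominator D: if D is even, X^2 + Y^2 + Z^2 = t D^2 is 0 modulo 4, so all
    three numerators are even and 2 cancels. For odd D, the even t makes X + Y + Z even. *)
Lemma even_sphere_odd_denom (t : nat) (v : 'rV[rat]_3) : ~~ odd t -> sqn v = t%:R ->
  exists (d : nat) (X Y Z : int), [/\ odd d, (2 %| X + Y + Z)%Z
    & v = vec3 (X%:~R / d%:R) (Y%:~R / d%:R) (Z%:~R / d%:R)].
Proof.
move=> et hv.
have [D [X [Y [Z [D_gt0 ev]]]]] : exists (D : nat) (X Y Z : int),
    (0 < D)%N /\ v = vec3 (X%:~R / D%:R) (Y%:~R / D%:R) (Z%:~R / D%:R).
  have den (x : rat) : exists (n : nat) (a : int), (0 < n)%N /\ x = a%:~R / n%:R.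
    exists (absz (denq x)), (numq x); rewrite absz_gt0 denq_neq0; split=> //.
    by rewrite pmulrn absz_denq divq_num_den.
  rewrite [v]vec3E; have [n1 [a1 [n1_gt0 ->]]] := den (v ord0 ord0).
  have [n2 [a2 [n2_gt0 ->]]] := den (v ord0 (lift ord0 ord0)).
  have [n3 [a3 [n3_gt0 ->]]] := den (v ord0 (lift ord0 (lift ord0 ord0))).
  exists (n1 * n2 * n3)%N, (a1 * (n2 * n3)%N%:Z), (a2 * (n1 * n3)%N%:Z), (a3 * (n1 * n2)%N%:Z).
  rewrite !muln_gt0 n1_gt0 n2_gt0 n3_gt0; split=> //.
  have [h1 h2 h3] : [/\ n1%:R != 0 :> rat, n2%:R != 0 :> rat & n3%:R != 0 :> rat].
    by rewrite !pnatr_eq0 -!lt0n.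
  by rewrite !PoszM !rmorphM /= -!pmulrn; congr vec3; field; rewrite h1 h2 h3.
elim/ltn_ind: D D_gt0 X Y Z ev => D IH D_gt0 X Y Z ev.
have D0 : D%:R != 0 :> rat by rewrite pnatr_eq0 -lt0n.
have eXYZ : X ^+ 2 + Y ^+ 2 + Z ^+ 2 = t%:Z * D%:Z ^+ 2.
  apply: (@intr_inj rat); rewrite !(rmorphD, rmorphM, rmorphXn) /= -!pmulrn -hv ev sqn_vec3.
  by field.
have [a [e1 ex]] := int_parity X; have [b [e2 ey]] := int_parity Y.
have [c [e3 ez]] := int_parity Z.
have [q1 h1] := sqr_parity a e1; have [q2 h2] := sqr_parity b e2.
have [q3 h3] := sqr_parity c e3.
have [oD|eD] := boolP (odd D).
  exists D, X, Y, Z; split=> //.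
  have [t' et'] : exists t', t = (2 * t')%N by exists t./2; move: et; clear; lia.
  move: eXYZ; rewrite ex ey ez h1 h2 h3 et' PoszM -mulrA; clear.
  by move: (_ * _ ^+ 2); case: e1 e2 e3 => -[] [] s; lia.
have eD2 : D = D./2.*2 by rewrite -{1}(odd_double_half D) (negbTE eD).
have D2_gt0 : (0 < D./2)%N by move: eD2 D_gt0; clear; lia.
have : [/\ e1 = false, e2 = false & e3 = false].
  move: eXYZ; rewrite ex ey ez h1 h2 h3 eD2 -mul2n PoszM exprMn mulrCA -[2%:Z ^+ 2]/(4 : int); clear.
  by move: (_ * _ ^+ 2); case: e1 e2 e3 => -[] [] s // h; exfalso; lia.
case=> e1f e2f e3f; rewrite e1f e2f e3f !addr0 in ex ey ez.
apply: (IH D./2 _ D2_gt0 a b c); first by move: eD2 D_gt0; clear; lia.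
have eDq : D%:R = 2 * D./2%:R :> rat by rewrite {1}eD2 -mul2n natrM.
have D20 : D./2%:R != 0 :> rat by rewrite pnatr_eq0 -lt0n.
by rewrite ev ex ey ez eDq !rmorphM /=; congr vec3; field.
Qed.

(** m and n0 are not both even and 4 does not divide n0, so the first two conditions each give m n0
    = 2 modulo 4. *)
Lemma squarefree_part_mod4 m n n0 : coprime m n -> is_squarefree_part n n0 ->
  m = 2 %[mod 4] \/ ~~ odd n0 \/ (odd n0 /\ (m * n0)%N = 1 %[mod 4]) ->
  (m * n0 %% 4 == 1)%N || (m * n0 %% 4 == 2)%N.
Proof.
move=> cmn [sq0 [k en]]; have cm0 : coprime m n0.
  by apply: coprime_dvdr cmn; rewrite en dvdn_mulr.
have n4 : (n0 %% 4 != 0)%N by apply/negP => /(sq0 2%N).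
have not_both : ~~ (~~ odd m && ~~ odd n0).
  apply/negP; rewrite -!dvdn2 => /andP[m2 n2].
  by have := dvdn_gcd 2 m n0; rewrite m2 n2 (eqP cm0).
have par x : odd (x %% 4) = odd x by lia.
case=> [m4|[e0|[_ /eqP ->]//]].
  move: not_both; rewrite -modnMm m4; have : (n0 %% 4 < 4)%N by rewrite ltn_mod.
  by rewrite -(par m) -(par n0) m4; case: (n0 %% 4)%N => [|[|[|[|]]]].
move: not_both n4; rewrite -modnMm -(par m) -(par n0); rewrite -par in e0; move: e0.
have : (n0 %% 4 < 4)%N by rewrite ltn_mod.
have : (m %% 4 < 4)%N by rewrite ltn_mod.
by case: (n0 %% 4)%N => [|[|[|[|]]]] //; case: (m %% 4)%N => [|[|[|[|]]]].
Qed.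

Theorem theorem5 (R : realType) (t : nat) (v : 'rV[rat]_3) (m n n0 : nat)
    (ht : T t) (hv : enorm R v = Num.sqrt (t%:R))
    (hm : (0 < m)%N) (hn : (0 < n)%N) (hmn : coprime m n)
    (hn0 : is_squarefree_part n n0)
    (hcond : m = 2 %[mod 4]
             \/ ~~ odd n0
             \/ (odd n0 /\ (m * n0)%N = 1 %[mod 4])) :
  finite_sums (rat_sphere R (m%:R / n%:R)) v.
Proof.
have M4 := squarefree_part_mod4 hmn hn0 hcond.
case: ht => _ _ t_even _; case: hn0 => sq0 [k en].
have n0_gt0 := squarefree_gt0 sq0.
have k_gt0 : (0 < k)%N by move: hn; rewrite en muln_gt0 expn_gt0 orbF => /andP[].
have sv : sqn v = t%:R.
  by apply/(rat_sphereE R v (ler0n _ t)); rewrite /rat_sphere ratr_nat.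
have [d [X [Y [Z [od /dvdzP[q eq] ev]]]]] := even_sphere_odd_denom t_even sv.
(* As (m / n) c^2 = m n0, scaling by c carries the given sphere to that of squared length m n0; even
   coordinate sums stay even. *)
pose c := (n0 * k)%N.
have c0 : c%:R != 0 :> rat by rewrite pnatr_eq0 -lt0n muln_gt0 n0_gt0.
have M_gt0 : (0 < m * n0)%N by rewrite muln_gt0 hm.
have [|s [hs es]] := @sphere_sum_even (m * n0) d (c%:Z * X) (c%:Z * Y) (c%:Z * Z) M_gt0 M4 od.
  by apply/dvdzP; exists (c%:Z * q); rewrite -!mulrDr eq mulrA.
exists [seq c%:R^-1 *: x | x <- s]; split=> [y /mapP[x xs ->]|].
  apply/rat_sphereE; first by rewrite divr_ge0 ?ler0n.
  rewrite sqnZ hs // en /c !natrM; field.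
  by rewrite !pnatr_eq0 -!lt0n n0_gt0 k_gt0.
rewrite big_map -scaler_sumr -es vec3Z ev.
by congr vec3; rewrite (rmorphM _ c%:Z) /= -pmulrn -mulrA mulKf.
Qed.
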